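(* Let $a,b\in\operatorname{Alg}\mathcal{N}$ and let $\pi:\operatorname{Alg}\mathcal{N}\to\operatorname{Alg}\mathcal{N}/\mathcal{K}(\mathcal{N})$ be the quotient map. The multiplication operator $M_{\pi(a),\pi(b)}:\operatorname{Alg}\mathcal{N}/\mathcal{K}(\mathcal{N})\to\operatorname{Alg}\mathcal{N}/\mathcal{K}(\mathcal{N})$ is weakly compact if and only if $M_{\pi(a),\pi(b)}=0$.
   Context: $\mathcal{N}$ is a nest on a Hilbert space $H$: a totally ordered family of closed subspaces of $H$ containing $\{0\}$ and $H$ and closed under intersections and closed linear spans of arbitrary subfamilies. $\operatorname{Alg}\mathcal{N}$ is the algebra of all bounded operators $T$ on $H$ with $T(N)\subseteq N$ for all $N\in\mathcal{N}$. $\mathcal{K}(\mathcal{N})$ is the closed ideal of all compact operators belonging to $\operatorname{Alg}\mathcal{N}$, and the quotient carries the quotient norm. For elements $u,v$ of a Banach algebra $\mathcal{A}$, $M_{u,v}:\mathcal{A}\to\mathcal{A}$ is the map $M_{u,v}(x)=uxv$. *)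

(* Defs.v *)
From HB Require Import structures.
From mathcomp Require Import all_boot all_order all_algebra.
From mathcomp Require Import all_classical all_reals topology normedtype.
From mathcomp Require Import complex.

Set Implicit Arguments.
Unset Strict Implicit.
Unset Printing Implicit Defensive.

Import Order.TTheory GRing.Theory Num.Theory.
Import numFieldNormedType.Exports.

Local Open Scope classical_set_scope.
Local Open Scope complex_scope.
Local Open Scope ring_scope.

(* Complex Hilbert spaces: the scalar field is [R[i]], norms are [R[i]]-valued
   (and real), and the inner product is linear in its first argument. *)
HB.mixin Record hasInnerProduct (R : realType) (H : Type)
    & CompleteNormedModule R[i] H := {
  inner : {dot H for (@Num.conj R[i])};
  inner_norm : forall x : H, `|x| ^+ 2 = inner x x
}.

#[short(type="hilbertType")]
HB.structure Definition Hilbert (R : realType) :=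
  {H of CompleteNormedModule R[i] H & hasInnerProduct R H}.

Definition unit_ball {K : numFieldType} (V : normedModType K) : set V :=
  [set x | `|x| <= 1].
Arguments unit_ball {K} V.

Definition dual {K : numFieldType} (V : normedModType K) : Type :=
  {f : {linear V -> K^o} | continuous (f : V -> K^o)}.

(* The weak topology sigma(V, V'), i.e. the coarsest topology making every
   continuous linear functional continuous, on an alias of V. *)
Definition weak {K : numFieldType} (V : normedModType K) : Type :=
  sup_topology (fun f : dual V =>
    Topological.on (initial_topology (sval f : V -> K^o))).

HB.instance Definition _ (K : numFieldType) (V : normedModType K) :=
  Topological.copy (weak V)
    (sup_topology (fun f : dual V =>
      Topological.on (initial_topology (sval f : V -> K^o)))).

(* [precompact] is relative compactness (see [precompactE]), here taken in the
   weak topology of W; T is then automatically bounded. *)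
Definition weakly_compact_operator {K : numFieldType} {V W : normedModType K}
    (T : {linear V -> W}) : Prop :=
  precompact (T @` unit_ball V : set (weak W)).

Definition is_subspace {R : realType} {H : hilbertType R} (M : set H) : Prop :=
  M 0 /\ forall (a : R[i]) (x y : H), M x -> M y -> M (a *: x + y).

Definition lin_span {R : realType} {H : hilbertType R} (A : set H) : set H :=
  smallest is_subspace A.

(* F may be empty in the last two fields, which then amount to [nestT] and
   [nest0]. *)
Record nest (R : realType) (H : hilbertType R) := Nest {
  nest_set : set (set H);
  nest_subspace : forall M, nest_set M -> is_subspace M;
  nest_closed : forall M, nest_set M -> closed M;
  nest_total : forall M M', nest_set M -> nest_set M' ->
    M `<=` M' \/ M' `<=` M;
  nest0 : nest_set [set 0];
  nestT : nest_set setT;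
  nest_bigcap : forall F : set (set H), F `<=` nest_set ->
    nest_set (\bigcap_(M in F) M);
  nest_bigspan : forall F : set (set H), F `<=` nest_set ->
    nest_set (closure (lin_span (\bigcup_(M in F) M)))
}.

Section nest_algebra.
Context {R : realType} {H : hilbertType R} (N : nest H).

Definition nestalg_pred : {pred H -> H} := fun T =>
  `[< [/\ linear T, continuous T &
      forall M, nest_set N M -> forall x, M x -> M (T x)] >].

Record nestalg := NestAlg {
  nestalg_val :> H -> H;
  _ : nestalg_val \in nestalg_pred
}.

HB.instance Definition _ := [isSub for nestalg_val].
HB.instance Definition _ := [Choice of nestalg by <:].

Lemma nestalgP (T : H -> H) : reflect
  [/\ linear T, continuous T & forall M, nest_set N M ->
    forall x, M x -> M (T x)]
  (T \in nestalg_pred).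
Proof. exact: asboolP. Qed.

Fact nestalg_submod_closed : submod_closed nestalg_pred.
Proof.
split.
  apply/nestalgP; split.
  - by move=> a x y; rewrite /= scaler0 addr0.
  - exact: cst_continuous.
  - by move=> M NM x _; case: (nest_subspace NM).
move=> a S T /nestalgP[Sl Sc SN] /nestalgP[Tl Tc TN]; apply/nestalgP; split.
- move=> b x y; rewrite /= !fctE Sl Tl !scalerDr addrACA !scalerA.
  by rewrite (mulrC b).
- move=> x; apply: cvgD; last exact: Tc.
  by apply: cvgZr; exact: Sc.
- move=> M NM x Mx; apply: (nest_subspace NM).2; [exact: SN|exact: TN].
Qed.
HB.instance Definition _ := GRing.isSubmodClosed.Build R[i] (H -> H)
  nestalg_pred nestalg_submod_closed.
HB.instance Definition _ := [SubChoice_isSubLmodule of nestalg by <:].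

Lemma nestalg_linear (T : nestalg) : linear T.
Proof. by case: (nestalgP _ (valP T)). Qed.
HB.instance Definition _ (T : nestalg) :=
  GRing.isLinear.Build R[i] H H *:%R (nestalg_val T) (@nestalg_linear T).

Lemma nestalg_continuous (T : nestalg) : continuous T.
Proof. by case: (nestalgP _ (valP T)). Qed.

Lemma nestalg_stable (T : nestalg) M : nest_set N M -> forall x, M x -> M (T x).
Proof. by case: (nestalgP _ (valP T)) => _ _; apply. Qed.

Lemma nestalgE :
  (forall x, (0 : nestalg) x = 0) *
  (forall (S T : nestalg) x, (S + T) x = S x + T x) *
  (forall (T : nestalg) x, (- T) x = - T x) *
  (forall (c : R[i]) (T : nestalg) x, (c *: T) x = c *: T x).
Proof. by []. Qed.

Lemma nestalg_ext (S T : nestalg) : S =1 T -> S = T.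
Proof. by move=> ST; apply/val_inj/funext. Qed.

Fact nestalg_one_subproof : id \in nestalg_pred.
Proof. by apply/nestalgP; split=> // x. Qed.

Fact nestalg_mul_subproof (S T : nestalg) : S \o T \in nestalg_pred.
Proof.
apply/nestalgP; split.
- by move=> a x y /=; rewrite !linearP.
- by move=> x; apply: continuous_comp; exact: nestalg_continuous.
- by move=> M NM x Mx /=; do 2 apply: nestalg_stable => //.
Qed.

Definition nestalg_one := NestAlg nestalg_one_subproof.
Definition nestalg_mul (S T : nestalg) := NestAlg (nestalg_mul_subproof S T).

Fact nestalg_mulA : associative nestalg_mul.
Proof. by move=> S T U; exact: nestalg_ext. Qed.
Fact nestalg_mul1 : left_id nestalg_one nestalg_mul.
Proof. by move=> S; exact: nestalg_ext. Qed.
Fact nestalg_1mul : right_id nestalg_one nestalg_mul.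
Proof. by move=> S; exact: nestalg_ext. Qed.
Fact nestalg_mulDl : left_distributive nestalg_mul +%R.
Proof. by move=> S T U; exact: nestalg_ext. Qed.
Fact nestalg_mulDr : right_distributive nestalg_mul +%R.
Proof. by move=> S T U; apply: nestalg_ext => x /=; rewrite linearD. Qed.

(* The product is composition. The ring is not required to be nontrivial, as H
   may be the zero space. *)
HB.instance Definition _ := GRing.Zmodule_isPzRing.Build nestalg
  nestalg_mulA nestalg_mul1 nestalg_1mul nestalg_mulDl nestalg_mulDr.

Lemma nestalg_mulE (S T : nestalg) x : (S * T) x = S (T x).
Proof. by []. Qed.

Definition opnorm (T : nestalg) : R :=
  sup [set complex.Re `|T x| | x in unit_ball H].

Lemma Re_normE (V : normedZmodType R[i]) (x : V) : (complex.Re `|x|)%:C = `|x|.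
Proof. by rewrite RRe_real// normr_real. Qed.

Lemma opnorm_bound (T : nestalg) :
  has_sup [set complex.Re `|T x| | x in unit_ball H].
Proof.
split.
  exists (complex.Re `|T 0|); exists 0 => //=.
  by rewrite /unit_ball /= normr0.
have /linear_boundedP/pinfty_ex_gt0[M M0 TM] : bounded_near T (nbhs (0 : H)).
  by apply/linear_bounded_continuous; exact: nestalg_continuous.
exists (complex.Re M) => _ [x /= x1 <-].
rewrite -lecR Re_normE RRe_real ?gtr0_real//.
by apply: le_trans (TM x) _; rewrite ler_piMr// ltW.
Qed.

Lemma opnormP (T : nestalg) x : `|T x| <= (opnorm T)%:C * `|x|.
Proof.
have [->|x0] := eqVneq x 0; first by rewrite linear0 !normr0 mulr0.
have nx0 : 0 < `|x| by rewrite normr_gt0.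
rewrite -ler_pdivrMr// mulrC.
have -> : `|x|^-1 * `|T x| = `|T (`|x|^-1 *: x)|.
  by rewrite linearZ normrZ normfV normr_id.
rewrite -Re_normE lecR; apply: sup_upper_bound; first exact: opnorm_bound.
exists (`|x|^-1 *: x) => //.
by rewrite /unit_ball /= normrZ normfV normr_id mulVf// gt_eqF.
Qed.

Lemma opnorm_le (T : nestalg) (c : R) :
  (forall x, `|x| <= 1 -> `|T x| <= c%:C) -> opnorm T <= c.
Proof.
move=> Tc; apply: ge_sup; first by case: (opnorm_bound T).
by move=> _ [x /= /Tc + <-]; rewrite -lecR Re_normE.
Qed.

Lemma opnorm_ge0 (T : nestalg) : 0 <= opnorm T.
Proof.
apply: (@le_trans _ _ (complex.Re `|T 0|)).
  by rewrite -lecR Re_normE; exact: normr_ge0.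
apply: sup_upper_bound; first exact: opnorm_bound.
by exists 0 => //; rewrite /unit_ball /= normr0.
Qed.

Lemma opnorm_ball (T : nestalg) x : `|x| <= 1 -> `|T x| <= (opnorm T)%:C.
Proof.
move=> x1; apply: le_trans (opnormP T x) _.
by rewrite ler_piMr// (lecR 0) opnorm_ge0.
Qed.

Fact nestalg_normD (S T : nestalg) :
  (opnorm (S + T))%:C <= (opnorm S)%:C + (opnorm T)%:C.
Proof.
rewrite -rmorphD lecR; apply: opnorm_le => x x1.
rewrite nestalgE rmorphD/=; apply: le_trans (ler_normD _ _) _.
by apply: lerD; exact: opnorm_ball.
Qed.

Lemma opnormZ_le (c : R[i]) (T : nestalg) :
  (opnorm (c *: T))%:C <= `|c| * (opnorm T)%:C.
Proof.
have cE : `|c| = (complex.Re `|c|)%:C by rewrite RRe_real// normr_real.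
rewrite cE -rmorphM lecR; apply: opnorm_le => x x1.
rewrite nestalgE normrZ rmorphM/= -cE ler_wpM2l//.
exact: opnorm_ball.
Qed.

Fact nestalg_normZ (c : R[i]) (T : nestalg) :
  (opnorm (c *: T))%:C = `|c| * (opnorm T)%:C.
Proof.
apply/eqP; rewrite eq_le opnormZ_le/=.
have [->|c0] := eqVneq c 0.
  by rewrite normr0 mul0r (lecR 0) opnorm_ge0.
rewrite -ler_pdivlMl ?normr_gt0// -normfV.
by rewrite -{1}(scale1r T) -(mulVf c0) -scalerA opnormZ_le.
Qed.

Fact nestalg_norm0 (T : nestalg) : (opnorm T)%:C = 0 -> T = 0.
Proof.
move=> T0; apply: nestalg_ext => x; apply/eqP.
by have := opnormP T x; rewrite T0 mul0r normr_le0.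
Qed.

HB.instance Definition _ := Lmodule_isNormed.Build R[i] nestalg
  nestalg_normD nestalg_normZ nestalg_norm0.

Lemma nestalg_normE (T : nestalg) : `|T| = (opnorm T)%:C.
Proof. by []. Qed.

End nest_algebra.
Section precompact_sets.
Context {K : numFieldType}.

Lemma precompact_image {V W : normedModType K} (f : V -> W) (A : set V) :
  continuous f -> precompact A -> precompact (f @` A).
Proof.
move=> fc; rewrite [precompact A]precompactE => cA.
apply: (@precompact_subset _ _ (f @` closure A)).
  exact/image_subset/subset_closure.
have cfA : compact (f @` closure A).
  by apply: continuous_compact => //; exact: continuous_subspaceT.
by rewrite precompact_closed//; apply: compact_closed.
Qed.

Lemma precompactD {V : normedModType K} (A B : set V) :
  precompact A -> precompact B ->
  precompact [set z | exists x y, [/\ A x, B y & z = x + y]].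
Proof.
rewrite [precompact A]precompactE [precompact B]precompactE => cA cB.
have cAB : compact ((fun z : V * V => z.1 + z.2) @` (closure A `*` closure B)).
  apply: continuous_compact; last exact: compact_setX.
  apply: continuous_subspaceT; exact: add_continuous.
apply: (@precompact_subset _ _
    ((fun z : V * V => z.1 + z.2) @` (closure A `*` closure B))).
  move=> _ [x [y [Ax By ->]]].
  by exists (x, y) => //; split; exact: subset_closure.
by rewrite precompact_closed//; apply: compact_closed.
Qed.

Lemma precompact_approx {V : completeNormedModType K} (A : set V) :
  (forall e : K, 0 < e -> exists2 B : set V, precompact B &
    forall x, A x -> exists2 y, B y & `|x - y| <= e) ->
  precompact A.
Proof.
move=> AB; rewrite precompactE compact_ultra => F UF FA.
have FF := @ultra_proper _ _ UF.
suff /cvg_ex[/= l Fl] : cvg F.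
  exists l; split; last exact: Fl.
  by apply: (closed_cvg _ (@closed_closure _ A) _ l Fl); exact: FA.
apply: cauchy_cvg; apply/cauchyP => e e0.
have d0 : 0 < e / 2 by rewrite divr_gt0.
have d'0 : 0 < e / 2 / 2 by rewrite divr_gt0.
have [B + ABe] := AB _ d'0; rewrite precompactE => cB.
pose G := filter_from F
  (fun U => [set y | closure B y /\ exists2 x, U x & `|x - y| <= e / 2]).
have GF : ProperFilter G.
  apply: filter_from_proper; last first.
    move=> U FU; have [x [Ux cAx]] := filter_ex (filterI FU FA).
    have [x' [Ax' xx']] := cAx _ (nbhsx_ballx x _ d'0).
    have [y By x'y] := ABe _ Ax'.
    exists y; split; first exact: subset_closure.
    exists x => //; rewrite -(subrKA x') (le_trans (ler_normD _ _))//.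
    rewrite [leRHS]splitr lerD//; apply: ltW.
    by move: xx'; rewrite -ball_normE.
  apply: filter_from_filter; first by exists setT; exact: filterT.
  move=> U U' FU FU'; exists (U `&` U'); first exact: filterI.
  by move=> y [By [x [Ux U'x] xy]]; split; split=> //; exists x.
have [|p [Bp clp]] := cB G GF.
  by exists setT; [exact: filterT|move=> y []].
exists p.
have [//|FnU] := in_ultra_setVsetC (ball p e) UF.
have GU : G [set y | closure B y /\
    exists2 x, (~` ball p e) x & `|x - y| <= e / 2].
  by exists (~` ball p e).
have [y [[By [x nx xy]] py]] := clp _ _ GU (nbhsx_ballx p _ d0).
exfalso; apply: nx; move: py; rewrite -!ball_normE /= => py.
rewrite -(subrKA y) (le_lt_trans (ler_normD _ _))//.
by rewrite [ltRHS]splitr ltr_leD// distrC.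
Qed.

End precompact_sets.
Section nest_quotient.
Context {R : realType} {H : hilbertType R} (N : nest H).
Local Open Scope quotient_scope.

Definition compact_operator (T : nestalg N) : Prop :=
  precompact (T @` unit_ball H).

Definition compact_ideal : {pred nestalg N} :=
  fun T => `[< compact_operator T >].

Lemma compact_idealP (T : nestalg N) :
  reflect (compact_operator T) (T \in compact_ideal).
Proof. exact: asboolP. Qed.

Lemma compact_operator_scale (c : R[i]) (T : nestalg N) :
  compact_operator T -> precompact ((fun x => c *: T x) @` unit_ball H).
Proof.
move=> /(@precompact_image _ _ _ (fun y => c *: y)).
rewrite image_comp; apply; exact: scaler_continuous.
Qed.

Fact compact_ideal_submod_closed : submod_closed compact_ideal.
Proof.
split.
  apply/compact_idealP; apply: (@precompact_subset _ _ [set 0]).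
    by move=> _ [x _ <-].
  rewrite precompactE -(closure_id _).1; first exact: compact_set1.
  exact/accessible_closed_set1/hausdorff_accessible/norm_hausdorff.
move=> a S T /compact_idealP cS /compact_idealP cT; apply/compact_idealP.
apply: precompact_subset (precompactD (compact_operator_scale a cS) cT).
move=> _ [x x1 <-]; exists (a *: S x), (T x).
by split=> //; exists x.
Qed.
HB.instance Definition _ := GRing.isSubmodClosed.Build R[i] (nestalg N)
  compact_ideal compact_ideal_submod_closed.

Lemma compact_idealMl (S T : nestalg N) :
  T \in compact_ideal -> S * T \in compact_ideal.
Proof.
move=> /compact_idealP cT; apply/compact_idealP.
have := precompact_image (@nestalg_continuous _ _ _ S) cT.
by rewrite image_comp.
Qed.

Lemma compact_idealMr (S T : nestalg N) :
  S \in compact_ideal -> S * T \in compact_ideal.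
Proof.
move=> /compact_idealP cS; apply/compact_idealP.
pose c : R[i] := `|T| + 1.
have c0 : 0 < c by rewrite ltr_wpDl.
apply: precompact_subset (compact_operator_scale c cS).
move=> _ [x x1 <-]; exists (c^-1 *: T x).
  rewrite /unit_ball/= normrZ normfV gtr0_norm// ler_pdivrMl// mulr1.
  by apply: le_trans (opnorm_ball T x1) _; rewrite -nestalg_normE lerDl.
by rewrite linearZ scalerA mulfV ?gt_eqF// scale1r.
Qed.

Lemma compact_ideal_closed (T : nestalg N) :
  (forall e : R[i], 0 < e -> exists2 S, S \in compact_ideal & `|T - S| <= e) ->
  T \in compact_ideal.
Proof.
move=> TS; apply/compact_idealP; apply: precompact_approx => e /TS[S KS STe].
exists (S @` unit_ball H); first exact/compact_idealP.
move=> _ [x x1 <-]; exists (S x); first by exists x.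
by apply: le_trans STe; exact: (opnorm_ball (T - S) x1).
Qed.

(* Alg N / K(N). The library puts only a group structure on a quotient by a
   (two-sided) ideal of a noncommutative ring; products, scalars and the norm
   are added below so that [quot_map] is a ring and module morphism. *)
Definition nestquot : Type := Quotient.quot compact_ideal.
HB.instance Definition _ := Choice.on nestquot.
HB.instance Definition _ := GRing.Zmodule.on nestquot.
HB.instance Definition _ := EqQuotient.on nestquot.

Definition quot_map (T : nestalg N) : nestquot := \pi_nestquot T.

Lemma quot_mapP (S T : nestalg N) :
  quot_map S = quot_map T <-> S - T \in compact_ideal.
Proof.
have := Quotient.idealrBE compact_ideal S T => ->.
by split=> [/eqP|/eqP].
Qed.

Lemma quot_map_surj (q : nestquot) : exists T, quot_map T = q.
Proof. by exists (repr q); exact: reprK. Qed.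

Fact quot_map_zmod_morphism : zmod_morphism quot_map.
Proof.
exact: (pi_is_zmod_morphism (Quotient.quot compact_ideal)).
Qed.
HB.instance Definition _ := GRing.isZmodMorphism.Build (nestalg N) nestquot
  quot_map quot_map_zmod_morphism.

Definition quot_one : nestquot := quot_map 1.
Definition quot_mul (p q : nestquot) : nestquot := quot_map (repr p * repr q).
Definition quot_scale (c : R[i]) (q : nestquot) : nestquot :=
  quot_map (c *: repr q).

Lemma repr_quot_map (T : nestalg N) : T - repr (quot_map T) \in compact_ideal.
Proof. by apply/quot_mapP; rewrite [RHS]reprK. Qed.

Fact quot_map_mul (S T : nestalg N) :
  quot_map (S * T) = quot_mul (quot_map S) (quot_map T).
Proof.
apply/quot_mapP; set S' := repr _; set T' := repr _.
have -> : S * T - S' * T' = (S - S') * T + S' * (T - T').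
  by rewrite mulrBl mulrBr addrA subrK.
by apply: rpredD; [apply: compact_idealMr|apply: compact_idealMl];
  exact: repr_quot_map.
Qed.

Fact quot_map_scale (c : R[i]) (T : nestalg N) :
  quot_map (c *: T) = quot_scale c (quot_map T).
Proof. by apply/quot_mapP; rewrite -scalerBr rpredZ// repr_quot_map. Qed.

Fact quot_mulA : associative quot_mul.
Proof.
move=> p q r; case: (quot_map_surj p) (quot_map_surj q) (quot_map_surj r)
  => [S <-] [T <-] [U <-].
by rewrite -!quot_map_mul mulrA.
Qed.
Fact quot_mul1 : left_id quot_one quot_mul.
Proof.
by move=> p; case: (quot_map_surj p) => S <-; rewrite -quot_map_mul mul1r.
Qed.
Fact quot_1mul : right_id quot_one quot_mul.
Proof.
by move=> p; case: (quot_map_surj p) => S <-; rewrite -quot_map_mul mulr1.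
Qed.
Fact quot_mulDl : left_distributive quot_mul +%R.
Proof.
move=> p q r; case: (quot_map_surj p) (quot_map_surj q) (quot_map_surj r)
  => [S <-] [T <-] [U <-].
by rewrite -raddfD -!quot_map_mul mulrDl raddfD.
Qed.
Fact quot_mulDr : right_distributive quot_mul +%R.
Proof.
move=> p q r; case: (quot_map_surj p) (quot_map_surj q) (quot_map_surj r)
  => [S <-] [T <-] [U <-].
by rewrite -raddfD -!quot_map_mul mulrDr raddfD.
Qed.
HB.instance Definition _ := GRing.Zmodule_isPzRing.Build nestquot
  quot_mulA quot_mul1 quot_1mul quot_mulDl quot_mulDr.

Fact quot_map_monoid_morphism : monoid_morphism quot_map.
Proof. by split=> // S T; exact: quot_map_mul. Qed.
HB.instance Definition _ := GRing.isMonoidMorphism.Build (nestalg N) nestquot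
  quot_map quot_map_monoid_morphism.

Fact quot_scaleA a b q : quot_scale a (quot_scale b q) = quot_scale (a * b) q.
Proof.
by case: (quot_map_surj q) => S <-; rewrite -!quot_map_scale scalerA.
Qed.
Fact quot_scale1 : left_id 1 quot_scale.
Proof.
by move=> q; case: (quot_map_surj q) => S <-; rewrite -quot_map_scale scale1r.
Qed.
Fact quot_scaleDr : right_distributive quot_scale +%R.
Proof.
move=> a p q; case: (quot_map_surj p) (quot_map_surj q) => [S <-] [T <-].
by rewrite -raddfD -!quot_map_scale scalerDr raddfD.
Qed.
Fact quot_scaleDl q : {morph quot_scale^~ q : a b / a + b}.
Proof.
move=> a b; case: (quot_map_surj q) => S <-.
by rewrite -!quot_map_scale scalerDl raddfD.
Qed.
HB.instance Definition _ := GRing.Zmodule_isLmodule.Build R[i] nestquot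
  quot_scaleA quot_scale1 quot_scaleDr quot_scaleDl.

HB.instance Definition _ := GRing.isScalable.Build R[i] (nestalg N) nestquot
  *:%R quot_map quot_map_scale.

Definition quot_norm (q : nestquot) : R :=
  inf [set complex.Re `|S| | S in [set S | quot_map S = q]].

Lemma quot_norm_has_inf (q : nestquot) :
  has_inf [set complex.Re `|S| | S in [set S | quot_map S = q]].
Proof.
split.
  by case: (quot_map_surj q) => S Sq; exists (complex.Re `|S|), S.
by exists 0 => _ [S _ <-]; rewrite nestalg_normE opnorm_ge0.
Qed.

Lemma quot_norm_ge0 (q : nestquot) : 0 <= quot_norm q.
Proof.
apply: lb_le_inf; first by case: (quot_norm_has_inf q).
by move=> _ [S _ <-]; rewrite nestalg_normE opnorm_ge0.
Qed.

Lemma quot_norm_le (T : nestalg N) : (quot_norm (quot_map T))%:C <= `|T|.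
Proof.
rewrite nestalg_normE lecR; apply: ge_inf; last by exists T.
by case: (quot_norm_has_inf (quot_map T)).
Qed.

Lemma quot_norm_adherent (q : nestquot) (e : R) : 0 < e ->
  exists2 T, quot_map T = q & `|T| < (quot_norm q + e)%:C.
Proof.
move=> e0; have [_ [T Tq <-] Tlt] := inf_adherent e0 (quot_norm_has_inf q).
by exists T => //; rewrite nestalg_normE ltcR.
Qed.

Fact quot_normD (p q : nestquot) :
  (quot_norm (p + q))%:C <= (quot_norm p)%:C + (quot_norm q)%:C.
Proof.
rewrite -rmorphD lecR; apply/ler_addgt0Pr => e e0.
have e20 : 0 < e / 2 by rewrite divr_gt0.
have [S <- Sp] := quot_norm_adherent p e20.
have [T <- Tq] := quot_norm_adherent q e20.
rewrite -raddfD -lecR; apply: le_trans (quot_norm_le _) _.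
apply: le_trans (ler_normD _ _) _.
rewrite [e in leRHS]splitr addrACA rmorphD.
by apply: lerD; exact: ltW.
Qed.

Lemma quot_normZ_le (c : R[i]) (q : nestquot) :
  (quot_norm (c *: q))%:C <= `|c| * (quot_norm q)%:C.
Proof.
have [->|c0] := eqVneq c 0.
  rewrite normr0 mul0r scale0r -(raddf0 quot_map) -(normr0 (nestalg N)).
  exact: quot_norm_le.
rewrite -ler_pdivrMl ?normr_gt0//.
have cE : `|c|^-1 = (complex.Re `|c^-1|)%:C.
  by rewrite -normfV RRe_real// normr_real.
rewrite cE -rmorphM lecR.
apply: lb_le_inf; first by case: (quot_norm_has_inf q).
move=> _ [S <- <-]; rewrite -lecR rmorphM/= -cE ler_pdivrMl ?normr_gt0//.
rewrite -linearZ; apply: le_trans (quot_norm_le _) _.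
by rewrite normrZ.
Qed.

Fact quot_normZ (c : R[i]) (q : nestquot) :
  (quot_norm (c *: q))%:C = `|c| * (quot_norm q)%:C.
Proof.
apply/eqP; rewrite eq_le quot_normZ_le/=.
have [->|c0] := eqVneq c 0.
  by rewrite normr0 mul0r (lecR 0) quot_norm_ge0.
rewrite -ler_pdivlMl ?normr_gt0// -normfV.
by rewrite -{1}(scale1r q) -(mulVf c0) -scalerA quot_normZ_le.
Qed.

Fact quot_norm0 (q : nestquot) : (quot_norm q)%:C = 0 -> q = 0.
Proof.
move=> [q0]; case: (quot_map_surj q) q0 => T <- T0.
rewrite -(raddf0 quot_map); apply/quot_mapP; rewrite subr0.
apply: compact_ideal_closed => e e0.
have eE : (complex.Re e)%:C = e by rewrite RRe_real ?gtr0_real.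
have e'0 : 0 < complex.Re e by rewrite -ltcR eE.
have [S /quot_mapP ST Se] := quot_norm_adherent (quot_map T) e'0.
exists (T - S); first by rewrite -opprB rpredN.
rewrite opprB addrC subrK; apply: ltW; rewrite -eE.
by move: Se; rewrite T0 add0r.
Qed.

HB.instance Definition _ := Lmodule_isNormed.Build R[i] nestquot
  quot_normD quot_normZ quot_norm0.

Lemma quot_normE (q : nestquot) : `|q| = (quot_norm q)%:C.
Proof. by []. Qed.

End nest_quotient.

Definition mulop {A : pzRingType} (u v : A) : A -> A := fun x => u * x * v.

Section mulop_linear.
Context {R : realType} {H : hilbertType R} {N : nest H}.

Fact mulop_linear (u v : nestquot N) : linear (mulop u v).
Proof.
move=> c x y.
case: (quot_map_surj u) (quot_map_surj v) (quot_map_surj x) (quot_map_surj y)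
  => [a <-] [b <-] [S <-] [T <-].
have mulopE U : mulop (quot_map a) (quot_map b) (quot_map U) =
    quot_map (a * U * b) by rewrite /mulop !rmorphM.
rewrite -linearP !mulopE -linearP; congr quot_map.
by apply: nestalg_ext => z; exact: (linearP a c (S (b z)) (T (b z))).
Qed.
HB.instance Definition _ (u v : nestquot N) :=
  GRing.isLinear.Build R[i] (nestquot N) (nestquot N) *:%R (mulop u v)
    (mulop_linear u v).

End mulop_linear.

(* Main.v *)
(* Suppose that [a x b] is not compact. Then the unit ball contains vectors [y] for
   which [b y] and [x (b y)] are almost orthogonal to any given finite set while
   [a (x (b y))] stays away from 0. Let [u = b y], [v = x u], let [M] be the
   smallest member of the nest which is close to [u] and [M_-] its predecessor. As
   [x] preserves the nest, [v] is close to [M], so that [s = P_M v] has a large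
   image under [a], while [t = u - P_{M_-} u] is not small, and the rank one operator
   [s (x) t] lies in Alg N. Repeating this yields almost orthogonal sequences [s k],
   [t k] such that for every set [A] of indices the sum of [s k (x) t k] over [A] is
   a bounded element of Alg N, which [M_{a,b}] maps to an almost diagonal operator.
   Ultrafilter limits of its matrix coefficients are functionals on the quotient,
   and they contradict weak compactness. *)

Require Import Defs.
From HB Require Import structures.
From mathcomp Require Import all_boot all_order all_algebra.
From mathcomp Require Import all_classical all_reals topology normedtype.
From mathcomp Require Import sequences complex ring lra.

Set Implicit Arguments.
Unset Strict Implicit.
Unset Printing Implicit Defensive.

Import Order.TTheory GRing.Theory Num.Theory.
Import numFieldNormedType.Exports.

Local Open Scope classical_set_scope.
Local Open Scope complex_scope.
Local Open Scope ring_scope.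

(** * Real-valued norms and limits along ultrafilters *)

Definition rnorm {R : rcfType} {V : normedZmodType R[i]} (x : V) : R :=
  complex.Re `|x|.

Lemma fmap_ultra (T U : Type) (f : T -> U) (F : set_system T) :
  UltraFilter F -> UltraFilter (f @ F).
Proof.
move=> UF; have FF := @ultra_proper _ _ UF; split.
  exact: fmap_proper_filter.
move=> G PG FG; rewrite eqEsubset; split=> // A GA.
have [//|FnA] := in_ultra_setVsetC (f @^-1` A) UF.
have /(filterI GA) : G (~` A) by exact: FG.
by rewrite setICr => /filter_not_empty.
Qed.

Section rnorm.
Context {R : realType}.
Implicit Types (V : normedModType R[i]).

Lemma rnormE V (x : V) : (rnorm x)%:C = `|x|.
Proof. exact: Re_normE. Qed.

Lemma rnorm_le V (x : V) (c : R) : (`|x| <= c%:C) = (rnorm x <= c).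
Proof. by rewrite -rnormE lecR. Qed.

Lemma rnorm_ge0 V (x : V) : 0 <= rnorm x.
Proof. by rewrite -lecR rnormE normr_ge0. Qed.

Lemma rnorm0 V : rnorm (0 : V) = 0.
Proof. by rewrite /rnorm normr0. Qed.

Lemma rnorm_eq0 V (x : V) : rnorm x = 0 -> x = 0.
Proof. by move=> x0; apply/normr0_eq0; rewrite -rnormE x0. Qed.

Lemma rnormN V (x : V) : rnorm (- x) = rnorm x.
Proof. by rewrite /rnorm normrN. Qed.

Lemma rnormD V (x y : V) : rnorm (x + y) <= rnorm x + rnorm y.
Proof. by rewrite -lecR rmorphD /= !rnormE ler_normD. Qed.

Lemma rnormB V (x y : V) : rnorm (x - y) <= rnorm x + rnorm y.
Proof. by rewrite -(rnormN y) rnormD. Qed.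

Lemma rnormC V (x y : V) : rnorm (x - y) = rnorm (y - x).
Proof. by rewrite -rnormN opprB. Qed.

Lemma rnormZ V (c : R[i]) (x : V) :
  rnorm (c *: x) = rnorm (c : R[i]^o) * rnorm x.
Proof.
by apply: complexI; rewrite rmorphM /= !rnormE normrZ.
Qed.

Lemma rnormM (c d : R[i]^o) :
  rnorm (c * d : R[i]^o) = rnorm c * rnorm d.
Proof. exact: (rnormZ c d). Qed.

Lemma rnorm_real (c : R) : rnorm (c%:C : R[i]^o) = `|c|.
Proof. by rewrite /rnorm normc_def /= expr0n /= addr0 sqrtr_sqr. Qed.

Lemma rnorm_conj (c : R[i]^o) : rnorm (Num.conj c : R[i]^o) = rnorm c.
Proof. by rewrite /rnorm norm_conjC. Qed.

Lemma rnorm_sqr (c : R[i]^o) :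
  rnorm c ^+ 2 = complex.Re c ^+ 2 + complex.Im c ^+ 2.
Proof. by rewrite /rnorm normc_def /= sqr_sqrtr// addr_ge0// sqr_ge0. Qed.

Lemma Re_le_rnorm (c : R[i]^o) : `|complex.Re c| <= rnorm c.
Proof.
rewrite -ler_sqr ?nnegrE ?rnorm_ge0// rnorm_sqr real_normK ?num_real//.
by rewrite lerDl sqr_ge0.
Qed.

Lemma Im_le_rnorm (c : R[i]^o) : `|complex.Im c| <= rnorm c.
Proof.
rewrite -ler_sqr ?nnegrE ?rnorm_ge0// rnorm_sqr real_normK ?num_real//.
by rewrite lerDr sqr_ge0.
Qed.

Lemma rnorm_le_ReIm (c : R[i]^o) :
  rnorm c <= `|complex.Re c| + `|complex.Im c|.
Proof.
rewrite -ler_sqr ?nnegrE ?rnorm_ge0 ?addr_ge0// rnorm_sqr sqrrD.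
rewrite !real_normK ?num_real// -addrA lerD2l lerDr.
by rewrite mulrn_wge0// mulr_ge0.
Qed.

Lemma cvg_rnormP V (T : Type) (F : set_system T) (f : T -> V) (l : V) :
  Filter F ->
  (f @ F --> l) <-> (forall e : R, 0 < e -> \forall x \near F, rnorm (l - f x) <= e).
Proof.
move=> FF; split=> [/cvgrPdist_le fl e e0|fl].
  have := fl e%:C; rewrite (ltcR 0) => /(_ e0).
  by apply: filterS => x; rewrite rnorm_le.
apply/cvgrPdist_le => e e0.
have eE : (complex.Re e)%:C = e by rewrite RRe_real ?gtr0_real.
have e'0 : 0 < complex.Re e by rewrite -ltcR eE.
by apply: filterS (fl _ e'0) => x; rewrite -rnorm_le eE.
Qed.

Lemma rnorm_continuous V : continuous (@rnorm R V : V -> R).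
Proof.
move=> x; apply/cvgrPdist_le => e e0.
have := (cvg_rnormP id x (nbhs_filter x)).1 cvg_id e e0; apply: filterS => y xy.
apply: le_trans xy; rewrite ler_norml; apply/andP; split.
- have := rnormD (y - x) x; rewrite subrK (rnormC y x); lra.
- have := rnormD (x - y) y; rewrite subrK; lra.
Qed.

(** Real and imaginary parts range in the compact segment from [- B] to [B], where the image of an
    ultrafilter converges. *)
Lemma complex_bounded_cvg (T : Type) (F : set_system T) (u : T -> R[i]^o)
    (B : R) : UltraFilter F -> (forall x, rnorm (u x) <= B) -> cvg (u @ F).
Proof.
move=> UF uB; have FF := @ultra_proper _ _ UF.
have rcvg (v : T -> R) : (forall x, `|v x| <= B) -> exists l : R, v @ F --> l.
  move=> vB; have := @segment_compact R (- B) B; rewrite compact_ultra.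
  move=> /(_ (v @ F) (fmap_ultra v UF)) [].
    by apply: (@filterE _ F) => x; rewrite /= in_itv /= -ler_norml.
  by move=> l [_ ?]; exists l.
have [|l1 /cvgrPdist_le h1] := rcvg (fun x => complex.Re (u x)).
  by move=> x; exact: le_trans (Re_le_rnorm _) (uB x).
have [|l2 /cvgrPdist_le h2] := rcvg (fun x => complex.Im (u x)).
  by move=> x; exact: le_trans (Im_le_rnorm _) (uB x).
apply/cvg_ex; exists (l1 +i* l2); apply/cvg_rnormP => e e0.
have e20 : 0 < e / 2 by rewrite divr_gt0.
near=> x; apply: le_trans (rnorm_le_ReIm _) _.
rewrite raddfB /= [leRHS]splitr lerD//; first by near: x; exact: h1.
have -> : complex.Im (l1 +i* l2 - u x) = l2 - complex.Im (u x).
  by case: (u x).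
by near: x; exact: h2.
Unshelve. all: by end_near.
Qed.

End rnorm.

(** * Inner products and the Cauchy-Schwarz inequality *)

Section inner.
Context {R : realType} {H : hilbertType R}.
Implicit Types (x y z : H).

Definition rinner x y : R := complex.Re (inner x y).

Lemma innerC x y : inner y x = Num.conj (inner x y).
Proof. by rewrite (hermC (inner : {dot H for @Num.conj R[i]})) expr0 mul1r. Qed.

Lemma innerDl x y z : inner (x + y) z = inner x z + inner y z.
Proof. exact: linearDl. Qed.
Lemma innerZl c x y : inner (c *: x) y = c * inner x y.
Proof. exact: linearZl_LR. Qed.
Lemma innerDr x y z : inner z (x + y) = inner z x + inner z y.
Proof. exact: linearDr. Qed.
Lemma innerZr c x y : inner x (c *: y) = Num.conj c * inner x y.
Proof. exact: linearZr_LR. Qed.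
Lemma innerNl x y : inner (- x) y = - inner x y.
Proof. exact: linearNl. Qed.
Lemma innerNr x y : inner x (- y) = - inner x y.
Proof. exact: linearNr. Qed.
Lemma innerBl x y z : inner (x - y) z = inner x z - inner y z.
Proof. by rewrite innerDl innerNl. Qed.
Lemma inner0l x : inner 0 x = 0.
Proof. exact: linear0l. Qed.
Lemma inner0r x : inner x 0 = 0.
Proof. exact: linear0r. Qed.
Lemma inner_suml (I : Type) (r : seq I) (P : pred I) (F : I -> H) y :
  inner (\sum_(i <- r | P i) F i) y = \sum_(i <- r | P i) inner (F i) y.
Proof. exact: linear_sumlz. Qed.

Lemma inner_rnorm x : inner x x = (rnorm x ^+ 2)%:C.
Proof. by rewrite -inner_norm -rnormE rmorphXn. Qed.

Lemma rinner_rnorm x : rinner x x = rnorm x ^+ 2.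
Proof. by rewrite /rinner inner_rnorm. Qed.

Lemma rinnerC x y : rinner x y = rinner y x.
Proof. by rewrite /rinner (innerC y x); case: (inner y x). Qed.

Lemma rinnerDl x y z : rinner (x + y) z = rinner x z + rinner y z.
Proof. by rewrite /rinner innerDl raddfD. Qed.
Lemma rinnerNl x y : rinner (- x) y = - rinner x y.
Proof. by rewrite /rinner innerNl raddfN. Qed.
Lemma rinnerZl (c : R) x y : rinner (c%:C *: x) y = c * rinner x y.
Proof.
by rewrite /rinner innerZl; case: (inner x y) => a b /=; rewrite mul0r subr0.
Qed.

Lemma rnormD_sqr x y :
  rnorm (x + y) ^+ 2 = rnorm x ^+ 2 + 2 * rinner x y + rnorm y ^+ 2.
Proof.
rewrite -!rinner_rnorm !(rinnerDl, rinnerC _ (x + y)) (rinnerC y x).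
lra.
Qed.

Lemma rnormB_sqr x y :
  rnorm (x - y) ^+ 2 = rnorm x ^+ 2 - 2 * rinner x y + rnorm y ^+ 2.
Proof. rewrite rnormD_sqr rnormN rinnerC rinnerNl rinnerC; lra. Qed.

Lemma parallelogram x y :
  rnorm (x - y) ^+ 2 = 2 * rnorm x ^+ 2 + 2 * rnorm y ^+ 2 -
    4 * rnorm ((2^-1)%:C *: (x + y)) ^+ 2.
Proof.
rewrite rnormZ rnorm_real ger0_norm ?invr_ge0// exprMn rnormB_sqr rnormD_sqr.
rewrite expr2; lra.
Qed.

Lemma rinner_le x y : rinner x y <= rnorm x * rnorm y.
Proof.
have [/rnorm_eq0->|y0] := eqVneq (rnorm y) 0.
  by rewrite rnorm0 mulr0 /rinner inner0r.
have y_gt0 : 0 < rnorm y by rewrite lt_neqAle eq_sym y0 rnorm_ge0.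
have [/rnorm_eq0->|x0] := eqVneq (rnorm x) 0.
  by rewrite rnorm0 mul0r /rinner inner0l.
have x_gt0 : 0 < rnorm x by rewrite lt_neqAle eq_sym x0 rnorm_ge0.
(* Expanding this square gives twice [rnorm x * rnorm y] times the difference of the two sides. *)
have := sqr_ge0 (rnorm ((rnorm y)%:C *: x - (rnorm x)%:C *: y)).
rewrite rnormB_sqr !rnormZ !rnorm_real !ger0_norm ?rnorm_ge0//.
rewrite rinnerZl (rinnerC _ (_ *: _)) rinnerZl (rinnerC y x) => h.
have : 0 < rnorm x * rnorm y by rewrite mulr_gt0.
move=> p; rewrite -(ler_pM2l p); nra.
Qed.

(** Multiplying [x] by the conjugate of [inner x y] makes the inner product real and nonnegative,
    which reduces the claim to [rinner_le]. *)
Lemma cauchy_schwarz x y : rnorm (inner x y : R[i]^o) <= rnorm x * rnorm y.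
Proof.
set c : R[i]^o := inner x y.
have [->|c0] := eqVneq (rnorm c) 0; first by rewrite mulr_ge0 ?rnorm_ge0.
have c_gt0 : 0 < rnorm c by rewrite lt_neqAle eq_sym c0 rnorm_ge0.
have := rinner_le (Num.conj c *: x) y.
rewrite rnormZ rnorm_conj -mulrA /rinner innerZl.
have -> : complex.Re (Num.conj c * inner x y) = rnorm c ^+ 2.
  rewrite rnorm_sqr -/c; case: c {c0 c_gt0} => a b /=.
  by rewrite mulNr opprK !expr2.
by rewrite expr2 ler_pM2l.
Qed.

Lemma inner_continuousl y : continuous (fun x => inner x y : R[i]^o).
Proof.
move=> x; apply/cvg_rnormP => e e0.
have d0 : 0 < e / (rnorm y + 1) by rewrite divr_gt0// ltr_wpDl ?rnorm_ge0.
have := (cvg_rnormP id x (nbhs_filter x)).1 cvg_id _ d0; apply: filterS => z.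
rewrite -innerBl => xz; apply: le_trans (cauchy_schwarz _ _) _.
rewrite ler_pdivlMr ?ltr_wpDl ?rnorm_ge0// in xz; apply: le_trans xz.
by rewrite ler_wpM2l ?rnorm_ge0// lerDl.
Qed.

End inner.

(** * Completeness, orthogonal projections and the Riesz representation *)

Lemma rnorm_cauchy_cvg {R : realType} {V : completeNormedModType R[i]}
    (F : set_system V) : ProperFilter F ->
  (forall e : R, 0 < e -> exists x, F [set y | rnorm (x - y) <= e]) -> cvg F.
Proof.
move=> FF Fc; apply: cauchy_cvg; apply/cauchyP => e e0.
have eE : (complex.Re e)%:C = e by rewrite RRe_real ?gtr0_real.
have e'0 : 0 < complex.Re e by rewrite -ltcR eE.
have [|x Fx] := Fc (complex.Re e / 2); first by rewrite divr_gt0.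
exists x; apply: filterS Fx => y /= xy; rewrite -ball_normE /= -eE -rnormE ltcR.
by apply: le_lt_trans xy _; lra.
Qed.

Lemma half_scaleD {R : realType} {V : lmodType R[i]} (v : V) :
  (2^-1)%:C *: (v + v) = v.
Proof.
rewrite -mulr2n -[v *+ 2]scaler_nat scalerA fmorphV/= rmorph_nat mulVf ?scale1r//.
by rewrite pnatr_eq0.
Qed.

Section projection.
Context {R : realType} {H : hilbertType R}.
Implicit Types (x y z m : H) (M K C : set H).

(* By the parallelogram law, the points of nearly minimal norm in the smaller
   and smaller members of the chain form a Cauchy filter. *)
Lemma chain_bigcap_nonempty (F : set (set H)) C0 (B : R) :
  F C0 -> (forall x, C0 x -> rnorm x <= B) ->
  (forall C, F C -> closed C) -> (forall C, F C -> C !=set0) ->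
  (forall C, F C -> forall x y, C x -> C y -> C ((2^-1)%:C *: (x + y))) ->
  (forall C C', F C -> F C' -> C `<=` C' \/ C' `<=` C) ->
  exists p, forall C, F C -> C p.
Proof.
move=> FC0 C0B Fcl Fne Fmid Ftot.
pose sq C : set R := [set rnorm x ^+ 2 | x in C].
have sq_inf C : F C -> has_inf (sq C).
  move=> /Fne[x Cx]; split; first by exists (rnorm x ^+ 2), x.
  by exists 0 => _ [y _ <-]; exact: sqr_ge0.
have inf_le C x : F C -> C x -> inf (sq C) <= rnorm x ^+ 2.
  by move=> /sq_inf[_ hi] Cx; apply: ge_inf => //; exists x.
pose D := sup [set inf (sq C) | C in F].
have supD : has_sup [set inf (sq C) | C in F].
  split; first by exists (inf (sq C0)), C0.
  exists (B ^+ 2) => _ [C FC <-].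
  have [x [Cx C0x]] : C `&` C0 !=set0.
    have [/setIidl->|/setIidr->] := Ftot _ _ FC FC0; exact: Fne.
  apply: le_trans (inf_le _ _ FC Cx) _.
  by rewrite ler_sqr ?nnegrE ?C0B ?rnorm_ge0// (le_trans (rnorm_ge0 x)) ?C0B.
pose G := filter_from [set Ce : set H * R | F Ce.1 /\ 0 < Ce.2]
  (fun Ce => [set x | Ce.1 x /\ rnorm x ^+ 2 < D + Ce.2]).
have GF : ProperFilter G.
  apply: filter_from_proper.
    apply: filter_from_filter; first by exists (C0, 1).
    move=> [C e] [C' e'] [/= FC e0] [/= FC' e'0].
    have [CC'|C'C] := Ftot _ _ FC FC'.
    - exists (C, Num.min e e'); first by rewrite /= lt_min e0 e'0.
      move=> x /= [Cx]; rewrite -ltrBlDl lt_min !ltrBlDl => /andP[xe xe'].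
      by do !split => //; exact: CC'.
    - exists (C', Num.min e e'); first by rewrite /= lt_min e0 e'0.
      move=> x /= [Cx]; rewrite -ltrBlDl lt_min !ltrBlDl => /andP[xe xe'].
      by do !split => //; exact: C'C.
  move=> [C e] [/= FC e0].
  have [_ [x Cx <-] xe] := inf_adherent e0 (sq_inf _ FC).
  exists x; split=> //; apply: lt_le_trans xe _; rewrite lerD2r.
  by apply: sup_upper_bound => //; exists C.
have /cvg_ex[/= p Gp] : cvg G.
  apply: rnorm_cauchy_cvg => e e0.
  have d0 : 0 < e ^+ 2 / 8 by rewrite divr_gt0// exprn_gt0.
  have [_ [C FC <-] CD] := sup_adherent d0 supD.
  have GC : G [set x | C x /\ rnorm x ^+ 2 < D + e ^+ 2 / 8].
    by exists (C, e ^+ 2 / 8).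
  have [x [Cx xD]] := filter_ex GC; exists x.
  apply: filterS GC => y [Cy yD] /=.
  rewrite -ler_sqr ?nnegrE ?rnorm_ge0 ?(ltW e0)// parallelogram.
  have := inf_le _ _ FC (Fmid _ FC _ _ Cx Cy).
  set q := rnorm _ ^+ 2; rewrite -/D in CD; lra.
exists p => C FC; apply: (@closed_cvg _ _ G _ id C (Fcl _ FC) _ p Gp).
by exists (C, 1) => // x [].
Qed.

(** The foot of the perpendicular is picked by choice; [orthprojP] shows that it exists when [M] is
    a closed subspace, so the default 0 only matters for other sets. *)
Definition orthproj M z : H :=
  xget 0 [set p | M p /\ forall m, M m -> inner (z - p) m = 0].

Lemma subspaceB M x y : is_subspace M -> M x -> M y -> M (x - y).
Proof. by move=> [_ Ml] Mx My; rewrite addrC -scaleN1r; exact: Ml. Qed.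

Lemma subspaceZ M c x : is_subspace M -> M x -> M (c *: x).
Proof. by move=> [M0 Ml] Mx; rewrite -[c *: x]addr0; exact: Ml. Qed.

Lemma subspaceD M x y : is_subspace M -> M x -> M y -> M (x + y).
Proof. by move=> [_ Ml] Mx My; rewrite -(scale1r x); exact: Ml. Qed.

Lemma subspace_midpoint M x y z : is_subspace M -> M (x - y) -> M (x - z) ->
  M (x - (2^-1)%:C *: (y + z)).
Proof.
move=> Ms My Mz.
have -> : x - (2^-1)%:C *: (y + z) = (2^-1)%:C *: ((x - y) + (x - z)).
  by rewrite addrACA -opprD scalerBr half_scaleD.
by apply: subspaceZ => //; exact: subspaceD.
Qed.

Lemma orthogonal_of_minimal M x : is_subspace M ->
  (forall m, M m -> rnorm x <= rnorm (x - m)) ->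
  forall m, M m -> inner x m = 0.
Proof.
move=> Ms xmin.
have rorth m : M m -> rinner x m = 0.
  (* The real multiple [r / q] of [m] nearly minimizes the distance to [x]; the added 1 keeps [q]
     positive when [m] is 0. *)
  move=> Mm; set r := rinner x m; set q := rnorm m ^+ 2 + 1.
  have q0 : 0 < q by rewrite ltr_wpDl ?sqr_ge0.
  have := xmin ((r / q)%:C *: m) (subspaceZ _ Ms Mm).
  rewrite -ler_sqr ?nnegrE ?rnorm_ge0// rnormB_sqr rinnerC rinnerZl rinnerC -/r.
  rewrite rnormZ rnorm_real exprMn real_normK ?num_real// => h.
  have : 0 <= (r / q) ^+ 2 * (rnorm m ^+ 2) - 2 * (r / q * r) by lra.
  have -> : rnorm m ^+ 2 = q - 1 by rewrite /q addrK.
  move: q q0 {h} => q q0.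
  have -> : (r / q) ^+ 2 * (q - 1) - 2 * (r / q * r) = - (r / q) ^+ 2 * (q + 1).
    by field; rewrite gt_eqF.
  have [//|r0] := eqVneq r 0.
  have : 0 < (r / q) ^+ 2 * (q + 1).
    rewrite mulr_gt0 ?addr_gt0// lt_neqAle sqr_ge0 andbT eq_sym sqrf_eq0.
    by rewrite mulf_eq0 invr_eq0 negb_or r0 gt_eqF.
  lra.
move=> m Mm; apply: (@rnorm_eq0 _ R[i]^o); apply/eqP; rewrite -sqrf_eq0.
(* Replacing [m] by [inner x m *: m] turns the real part into the squared modulus of [inner x m]. *)
have := rorth _ (subspaceZ (inner x m) Ms Mm).
rewrite /rinner innerZr rnorm_sqr; case: (inner x m) => a b /= <-.
by rewrite mulNr opprK !expr2.
Qed.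

(** The vectors [x] of nearly minimal norm with [z - x] in [M] form a chain of closed sets stable
    under midpoints. A common point is a residual of minimal norm, and minimality forces
    orthogonality. *)
Lemma orthprojP M z : is_subspace M -> closed M ->
  M (orthproj M z) /\ forall m, M m -> inner (z - orthproj M z) m = 0.
Proof.
move=> Ms Mc; suff [p pP] : exists p, M p /\ forall m, M m -> inner (z - p) m = 0.
  have := @xgetPex _ 0 [set q | M q /\ forall m, M m -> inner (z - q) m = 0].
  by apply; exists p.
pose sq : set R := [set rnorm x ^+ 2 | x in [set x | M (z - x)]].
have Mz0 : M (z - z) by rewrite subrr; exact: Ms.1.
have sq_inf : has_inf sq.
  split; first by exists (rnorm z ^+ 2), z.
  by exists 0 => _ [y _ <-]; exact: sqr_ge0.
pose C (e : R) := [set x | M (z - x) /\ rnorm x ^+ 2 <= inf sq + e].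
have [||||||p pC] := @chain_bigcap_nonempty [set C e | e in [set e | 0 < e]]
    (C 1) (inf sq + 2).
- by exists 1 => //; exact: ltr01.
- move=> x [_ x1]; have i0 : 0 <= inf sq.
    by apply: lb_le_inf; [case: sq_inf|move=> _ [y _ <-]; exact: sqr_ge0].
  have := rnorm_ge0 x; nra.
- move=> _ [e e0 <-]; apply: closedI.
    apply: (@preimage_closed _ _ (fun x => z - x) M) => // x _.
    by apply: cvgB => //; exact: cvg_cst.
  apply: (@preimage_closed _ _ (fun x : H => rnorm x ^+ 2) [set r | r <= _]).
    by move=> x _; exact: (cvgM (@rnorm_continuous _ _ x) (@rnorm_continuous _ _ x)).
  exact: closed_le.
- move=> _ [e e0 <-]; have [_ [x Mx <-] xe] := inf_adherent e0 sq_inf.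
  by exists x; split=> //; exact: ltW.
- move=> _ [e e0 <-] x y [Mx xe] [My ye]; split.
    exact: subspace_midpoint.
  have := parallelogram x y; have := sqr_ge0 (rnorm (x - y)).
  by set q := rnorm (_ *: _) ^+ 2; lra.
- move=> _ _ [e e0 <-] [e' e'0 <-].
  have [ee'|/ltW ee'] := lerP e e'; [left|right] => x [Mx xe]; split => //;
    by apply: le_trans xe _; rewrite lerD2l.
- have Mp : M (z - p).
    by apply: (pC (C 1) _).1; exists 1 => //; exact: ltr01.
  exists (z - p); split=> //; rewrite subKr.
  apply: orthogonal_of_minimal => // m Mm.
  rewrite -ler_sqr ?nnegrE ?rnorm_ge0//.
  apply: (@le_trans _ _ (inf sq)).
    apply/ler_addgt0Pr => e e0; by apply: (pC (C e) _).2; exists e.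
  apply: ge_inf; first by case: sq_inf.
  by exists (p - m) => //=; rewrite opprB addrCA addrC; exact: subspaceD.
Qed.

Lemma orthproj_in M z : is_subspace M -> closed M -> M (orthproj M z).
Proof. by move=> Ms Mc; case: (orthprojP z Ms Mc). Qed.

Lemma orthproj_orth M z m : is_subspace M -> closed M -> M m ->
  inner (z - orthproj M z) m = 0.
Proof. by move=> Ms Mc; case: (orthprojP z Ms Mc) => _; apply. Qed.

Lemma orthproj_pythagoras M z m : is_subspace M -> closed M -> M m ->
  rnorm (z - m) ^+ 2 =
    rnorm (z - orthproj M z) ^+ 2 + rnorm (orthproj M z - m) ^+ 2.
Proof.
move=> Ms Mc Mm; rewrite -[z in LHS](subrK (orthproj M z)) -addrA.
rewrite (rnormD_sqr (z - orthproj M z)) /rinner orthproj_orth//=; first lra.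
by apply: subspaceB => //; exact: orthproj_in.
Qed.

Lemma orthproj_min M z m : is_subspace M -> closed M -> M m ->
  rnorm (z - orthproj M z) <= rnorm (z - m).
Proof.
move=> Ms Mc Mm; rewrite -ler_sqr ?nnegrE ?rnorm_ge0//.
by rewrite (orthproj_pythagoras z Ms Mc Mm) lerDl sqr_ge0.
Qed.

Lemma rnorm_orthproj M z : is_subspace M -> closed M ->
  rnorm (orthproj M z) <= rnorm z.
Proof.
move=> Ms Mc; rewrite -ler_sqr ?nnegrE ?rnorm_ge0//.
have := orthproj_pythagoras z Ms Mc Ms.1; rewrite !subr0 => ->.
by rewrite lerDr sqr_ge0.
Qed.

Lemma rnorm_orthproj_compl M z : is_subspace M -> closed M ->
  rnorm (z - orthproj M z) <= rnorm z.
Proof. by move=> Ms Mc; have := orthproj_min z Ms Mc Ms.1; rewrite subr0. Qed.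

Lemma inner_orthprojC M x y : is_subspace M -> closed M ->
  inner (orthproj M x) y = inner x (orthproj M y).
Proof.
move=> Ms Mc; apply/eqP; rewrite -subr_eq0; apply/eqP.
rewrite -{1}(subrK (orthproj M y) y) innerDr -addrA -innerBl.
rewrite -(opprB x) innerNl (orthproj_orth x)//; last exact: orthproj_in.
rewrite oppr0 addr0 innerC (orthproj_orth y)//; last exact: orthproj_in.
by rewrite rmorph0.
Qed.

(** The difference of the two projections is a difference of residuals, both orthogonal to [K], so
    Pythagoras applies. *)
Lemma orthproj_chain K M z : is_subspace K -> closed K -> is_subspace M ->
  closed M -> K `<=` M ->
  rnorm (orthproj M z - orthproj K z) ^+ 2 =
    rnorm (orthproj M z) ^+ 2 - rnorm (orthproj K z) ^+ 2.
Proof.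
move=> Ks Kc Ms Mc KM; have KP := orthproj_in z Ks Kc.
rewrite -[in X in _ = X - _](subrK (orthproj K z) (orthproj M z)).
rewrite (rnormD_sqr (orthproj M z - orthproj K z)).
suff -> : rinner (orthproj M z - orthproj K z) (orthproj K z) = 0 by lra.
rewrite /rinner -(subrKA z) innerDl (orthproj_orth z Ks Kc)// addr0.
rewrite -opprB innerNl (orthproj_orth z Ms Mc) ?oppr0//; exact: KM.
Qed.

(** The residual [e] of a vector outside the kernel is orthogonal to the kernel, which contains
    [x - (f x / f e) *: e] for every [x]. Pairing with [e] and solving for [f x] gives the
    vector. *)
Lemma riesz_representation (f : {linear H -> R[i]^o}) :
  continuous (f : H -> R[i]^o) -> exists w, forall x, f x = inner x w.
Proof.
move=> fc; pose K := [set x | f x = 0].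
have Ks : is_subspace K.
  split; first by rewrite /K /= linear0.
  by move=> c x y; rewrite /K /= linearP => -> ->; rewrite scaler0 addr0.
have Kc : closed K.
  apply: (@preimage_closed _ _ (f : H -> R[i]^o) [set 0]).
    by move=> x _; exact: fc.
  exact/accessible_closed_set1/hausdorff_accessible/norm_hausdorff.
have [f0|/existsNP[x0 fx0]] := pselect (forall x, f x = 0).
  by exists 0 => x; rewrite f0 inner0r.
pose e := x0 - orthproj K x0.
have fe : f e <> 0 by rewrite /e linearB /= (orthproj_in x0 Ks Kc) subr0.
have e0 : inner e e != 0.
  apply/eqP => e0; apply: fe; suff -> : e = 0 by rewrite linear0.
  by apply: normr0_eq0; apply/eqP; rewrite -sqrf_eq0 inner_norm e0.
exists ((Num.conj (f e / inner e e)) *: e) => x.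
have /(orthproj_orth x0 Ks Kc) : K (x - (f x / f e) *: e).
  rewrite /K /= linearB linearZ /= /GRing.scale /= divfK ?subrr//.
  exact/eqP.
rewrite -/e innerC => /eqP; rewrite conjC_eq0 innerBl innerZl subr_eq0 => /eqP xe.
rewrite innerZr conjCK xe; move/eqP: fe e0.
by move: (f e : R[i]) (inner e e) (f x : R[i]) => p q r p0 q0; field; rewrite p0.
Qed.

End projection.

(** * Finite partitions on which bounded functions hardly vary *)

Section finite_code.
Context {R : realType}.

(** Each value is shifted by [B] and rounded down to a multiple of [e]; boundedness leaves finitely
    many codes. *)
Lemma finite_code (T : Type) (I : finType) (D : set T) (f : I -> T -> R)
    (B e : R) : 0 < e -> (forall i x, D x -> `|f i x| <= B) ->
  exists (K : finType) (c : T -> K), forall x y, D x -> D y -> c x = c y ->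
    forall i, `|f i x - f i y| <= e.
Proof.
move=> e0 fB; pose n := Num.truncn ((B + B) / e).
pose c x := [ffun i => inord (Num.truncn ((f i x + B) / e)) : 'I_n.+1].
exists {ffun I -> 'I_n.+1}, c => x y Dx Dy /ffunP cxy i.
have pos z : D z -> 0 <= (f i z + B) / e.
  by move=> Dz; rewrite divr_ge0 ?(ltW e0)//; have := fB i z Dz;
    rewrite ler_norml; lra.
have cE z : D z -> c z i = Num.truncn ((f i z + B) / e) :> nat.
  move=> Dz; rewrite ffunE inordK// ltnS le_truncn// ler_pM2r ?invr_gt0//.
  by rewrite lerD2r; exact: le_trans (ler_norm _) (fB i z Dz).
have /(congr1 val) /= := cxy i; rewrite !cE// => xy.
have /truncn_itv/andP[] := pos x Dx; have /truncn_itv/andP[] := pos y Dy.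
rewrite -xy; set m := Num.truncn _ => y1 y2 x1 x2; move: y1 y2 x1 x2.
rewrite !ler_pdivlMr// !ltr_pdivrMr// -natr1 => y1 y2 x1 x2.
rewrite ler_norml; apply/andP; split; nra.
Qed.

End finite_code.

(** * Noncompact operators and projections on the nest *)

Section nest_operators.
Context {R : realType} {H : hilbertType R} (N : nest H).
Implicit Types (S T : nestalg N) (x y z v : H).

Lemma rnorm_opnorm T x : rnorm (T x) <= opnorm T * rnorm x.
Proof. by rewrite -lecR rmorphM /= !rnormE; exact: opnormP. Qed.

(** Riesz representation for each [y], then choice. The adjoint is a bare function, as it may fail
    to preserve the nest. *)
Lemma adjoint_ex T : exists A : H -> H, forall x y, inner (T x) y = inner x (A y).
Proof.
suff /choice[A TA] : forall y, exists w, forall x, inner (T x) y = inner x w.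
  by exists A => x y; exact: TA.
move=> y; pose f x : R[i]^o := inner (T x) y.
have fl : linear f by move=> c u v; rewrite /f linearP innerDl innerZl.
pose fL : {linear H -> R[i]^o} := HB.pack f (GRing.isLinear.Build _ _ _ _ f fl).
apply: (@riesz_representation _ _ fL) => x.
by apply: (@cvg_comp _ _ _ T (fun z => inner z y : R[i]^o));
  [exact: nestalg_continuous|exact: inner_continuousl].
Qed.

(* Otherwise, covering the unit ball by finitely many sets on which the
   functionals of [L] hardly vary shows that its image is totally bounded. *)
Lemma noncompact_weakly_small T : T \notin @compact_ideal _ _ N ->
  exists2 d : R, 0 < d & forall (L : seq (nestalg N * H)) (e : R), 0 < e ->
    exists x, [/\ rnorm x <= 1, d <= rnorm (T x) &
      forall p, p \in L -> rnorm (inner (p.1 x) p.2 : R[i]^o) <= e].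
Proof.
apply: contraNP => /forall2NP nd; apply/compact_idealP/precompact_approx => e e0.
have eE : (complex.Re e)%:C = e by rewrite RRe_real ?gtr0_real.
have e'0 : 0 < complex.Re e by rewrite -ltcR eE.
have d0 : 0 < complex.Re e / 2 by rewrite divr_gt0.
have [//|/existsNP[L /existsNP[r /not_implyP[r0 /forallNP small]]]] :=
  nd (complex.Re e / 2).
pose h (p : nestalg N * H) x : R[i]^o := inner (p.1 x) p.2.
(* The Boolean selects the real or the imaginary part, since [finite_code] handles real
   functions. *)
pose f (ib : 'I_(size L) * bool) x :=
  let w := h (nth (0, 0) L ib.1) x in if ib.2 then complex.Re w else complex.Im w.
pose B := \sum_(i < size L)
  opnorm (nth (0, 0) L i).1 * rnorm (nth (0, 0) L i).2.
have hB (i : 'I_(size L)) x : rnorm x <= 1 -> rnorm (h (nth (0, 0) L i) x) <= B.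
  move=> x1; apply: le_trans (cauchy_schwarz _ _) _; rewrite /B (bigD1 i)//=.
  rewrite -[leLHS]addr0 lerD//; last first.
    by apply: sumr_ge0 => j _; rewrite mulr_ge0 ?opnorm_ge0 ?rnorm_ge0.
  rewrite ler_wpM2r ?rnorm_ge0//; apply: le_trans (rnorm_opnorm _ _) _.
  by rewrite ler_piMr ?opnorm_ge0.
have [|K [c cP]] := @finite_code R H _ [set x | rnorm x <= 1] f B r r0.
  move=> [i []] x x1; rewrite /f /=.
    exact: le_trans (Re_le_rnorm _) (hB _ _ x1).
  exact: le_trans (Im_le_rnorm _) (hB _ _ x1).
pose rep k := xget 0 [set x | rnorm x <= 1 /\ c x = k].
exists [set T (rep k) | k in [set: K]].
  rewrite precompactE -(closure_id _).1.
    apply: finite_compact; exact: finite_image.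
  by apply: compact_closed; [exact: norm_hausdorff|];
    apply: finite_compact; exact: finite_image.
move=> _ [x x1 <-]; exists (T (rep (c x))); first by exists (c x).
have {}x1 : rnorm x <= 1 by rewrite -rnorm_le.
have [y1 cxy] : rnorm (rep (c x)) <= 1 /\ c (rep (c x)) = c x.
  by apply: (@xgetPex _ 0 [set y | rnorm y <= 1 /\ c y = c x]); exists x.
move: (rep (c x)) y1 cxy => y y1 cxy.
rewrite -linearB -eE -rnormE lecR.
(* Half the difference of two unit ball vectors is again in the unit ball, so [w] can contradict
   [small]; this is why [d] was taken to be half of the precision. *)
have -> : x - y = 2%:C *: ((2^-1)%:C *: (x - y)).
  by rewrite scalerA -rmorphM /= divff ?scale1r ?pnatr_eq0.
set w := _ *: (x - y); rewrite linearZ /= rnormZ rnorm_real gtr0_norm//.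
have w1 : rnorm w <= 1.
  rewrite rnormZ rnorm_real gtr0_norm ?invr_gt0//; have := rnormB x y; lra.
rewrite -ler_pdivlMl// mulrC leNgt; apply/negP => /ltW Tw.
apply: (small w); split=> // p pL.
have [i pE] : exists i : 'I_(size L), p = nth (0, 0) L i.
  have pi : (index p L < size L)%N by rewrite index_mem.
  by exists (Ordinal pi); rewrite /= nth_index.
have -> : inner (p.1 w) p.2 = (2^-1)%:C * (h p x - h p y) :> R[i]^o.
  by rewrite /w linearZ linearB /= innerZl innerBl.
rewrite (rnormM _ (h p x - h p y)) rnorm_real gtr0_norm ?invr_gt0//.
have := cP _ _ x1 y1 (esym cxy) (i, true).
have := cP _ _ x1 y1 (esym cxy) (i, false).
rewrite /f /= -pE; have := rnorm_le_ReIm (h p x - h p y).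
by rewrite !raddfB; lra.
Qed.

(* For [K `<=` M], [rnorm (P_M z - P_K z) ^+ 2] is the difference of
   [rnorm (P_M z) ^+ 2] and [rnorm (P_K z) ^+ 2], so the projections of [z] on
   the nest are parametrized by a bounded set of reals and are totally bounded. *)
Lemma nest_orthproj_uniformly_small (Z : seq H) (B e : R) : 0 <= B -> 0 < e ->
  exists (Y : seq H) (d : R), 0 < d /\ forall v, rnorm v <= B ->
    (forall y, y \in Y -> rnorm (inner v y : R[i]^o) <= d) ->
    forall z M, z \in Z -> nest_set N M ->
      rnorm (inner v (orthproj M z) : R[i]^o) <= e.
Proof.
(* Chosen so that [B * r <= e / 2]; the added 1 covers [B = 0]. *)
move=> B0 e0; pose r := e / 2 / (B + 1).
have r0 : 0 < r by rewrite !divr_gt0// ltr_wpDl.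
pose f (i : 'I_(size Z)) M := rnorm (orthproj M (nth 0 Z i)) ^+ 2.
have [|K [c cP]] := @finite_code R (set H) _ (nest_set N) f
    (\sum_(i < size Z) rnorm (nth 0 Z i) ^+ 2) (r ^+ 2) (exprn_gt0 _ r0).
  move=> i M NM; rewrite /f ger0_norm ?sqr_ge0// (bigD1 i)//=.
  rewrite -[leLHS]addr0 lerD ?sumr_ge0//; last by move=> *; exact: sqr_ge0.
  rewrite ler_sqr ?nnegrE ?rnorm_ge0//.
  by apply: rnorm_orthproj; [exact: nest_subspace NM|exact: nest_closed NM].
pose rep k := xget set0 [set M | nest_set N M /\ c M = k].
exists [seq orthproj (rep k) z | k <- enum K, z <- Z], (e / 2).
split; first by rewrite divr_gt0.
move=> v vB small z M zZ NM.
have [NP cMP] : nest_set N (rep (c M)) /\ c (rep (c M)) = c M.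
  by apply: (@xgetPex _ set0 [set P | nest_set N P /\ c P = c M]); exists M.
have /small : orthproj (rep (c M)) z \in
    [seq orthproj (rep k) z | k <- enum K, z <- Z].
  by apply/allpairsP; exists (c M, z); rewrite mem_enum.
move: (rep (c M)) NP cMP => P NP cMP Pz.
have PMr : rnorm (orthproj M z - orthproj P z) <= r.
  have zi : (index z Z < size Z)%N by rewrite index_mem.
  rewrite -ler_sqr ?nnegrE ?rnorm_ge0 ?(ltW r0)//.
  have := cP _ _ NM NP (esym cMP) (Ordinal zi); rewrite /f /= nth_index//.
  rewrite ler_norml => /andP[].
  have Ms := nest_subspace NM; have Mc := nest_closed NM.
  have Ps := nest_subspace NP; have Pc := nest_closed NP.
  have [PM|MP] := nest_total NP NM.
    by rewrite orthproj_chain//; lra.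
  by rewrite rnormC orthproj_chain//; lra.
rewrite -(subrK (orthproj P z) (orthproj M z)) innerDr.
apply: le_trans (rnormD _ _) _; rewrite [leRHS]splitr lerD//.
apply: le_trans (cauchy_schwarz _ _) _.
apply: (@le_trans _ _ (B * r)); first by apply: ler_pM; rewrite ?rnorm_ge0.
by rewrite /r mulrCA ler_piMr ?divr_ge0 ?(ltW e0)// ler_pdivrMr ?ltr_wpDl//; lra.
Qed.

End nest_operators.

(** * Rank one operators in the nest algebra *)

Section rank_one.
Context {R : realType} {H : hilbertType R} (N : nest H).
Implicit Types (a b x : nestalg N) (s t u z : H) (K M P : set H).

Lemma closed_sub_ball M u (c : R) : closed M ->
  closed [set y | M (u - y) /\ rnorm y <= c].
Proof.
move=> Mc; apply: closedI.
  apply: (@preimage_closed _ _ (fun y => u - y) M) => // y _.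
  by apply: cvgB => //; exact: cvg_cst.
apply: (@preimage_closed _ _ (@rnorm R H) [set r | r <= c]).
  by move=> y _; exact: rnorm_continuous.
exact: closed_le.
Qed.

(* [M] is the intersection of the members of the nest at distance at most [c]
   from [u], and [P] is its predecessor, the closed span of the members not
   containing [M]. *)
Lemma nest_cut x u (c : R) : 0 <= c -> c < rnorm u ->
  exists M P, [/\ nest_set N M, nest_set N P,
    forall K, nest_set N K -> M `<=` K \/ K `<=` P,
    rnorm (x u - orthproj M (x u)) <= opnorm x * c &
    c <= rnorm (u - orthproj P u)].
Proof.
move=> c0 cu.
pose S := [set M | nest_set N M /\ exists2 y, M (u - y) & rnorm y <= c].
have NS : S `<=` nest_set N by move=> M [].
have ST : S setT.
  by split; [exact: nestT|exists 0 => //; rewrite rnorm0].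
pose M := \bigcap_(K in S) K; have NM : nest_set N M := nest_bigcap NS.
pose F := [set K | nest_set N K /\ ~ (M `<=` K)].
have NF : F `<=` nest_set N by move=> K [].
pose P := closure (lin_span (\bigcup_(K in F) K)).
have NP : nest_set N P := nest_bigspan NF.
exists M, P; split=> //.
- move=> K NK; have [MK|MK] := pselect (M `<=` K); [by left|right].
  move=> y Ky; apply: subset_closure => L [Ls]; apply.
  by exists K.
(* Distance at most [c] passes to the intersection: the sets [C K] form a chain with a common point
   [p], and [u - p] lies in [M]. *)
- pose C K := [set y | K (u - y) /\ rnorm y <= c].
  have [||||||p pC] := @chain_bigcap_nonempty _ _ [set C K | K in S] (C setT) c.
  + by exists setT.
  + by move=> y [].
  + move=> _ [K [NK _] <-]; exact/closed_sub_ball/(nest_closed NK).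
  + by move=> _ [K [NK [y Ky yc]] <-]; exists y.
  + move=> _ [K [NK _] <-] y z [Ky yc] [Kz zc]; split.
      exact: subspace_midpoint (nest_subspace NK) Ky Kz.
    rewrite rnormZ rnorm_real ger0_norm ?invr_ge0//.
    by have := rnormD y z; lra.
  + move=> _ _ [K [NK _] <-] [K' [NK' _] <-].
    by have [KK|KK] := nest_total NK NK'; [left|right] => y [Ky yc];
      split=> //; exact: KK.
  + have pc : rnorm p <= c by apply: (pC (C setT) _).2; exists setT.
    have Mp : M (x (u - p)).
      apply: (@nestalg_stable _ _ N x M NM) => K SK.
      by apply: (pC (C K) _).1; exists K.
    apply: le_trans (orthproj_min _ (nest_subspace NM) (nest_closed NM) Mp) _.
    rewrite -linearB subKr; apply: le_trans (rnorm_opnorm _ _) _.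
    by rewrite ler_wpM2l ?opnorm_ge0.
(* Members of [F] do not contain [M], hence are not in [S], so all their points are farther than [c]
   from [u]; the bound with [<=] survives closure. *)
- have PC : P `<=` [set q | c <= rnorm (u - q)].
    rewrite [X in _ `<=` X](closure_id _).1.
      apply: closureS => q.
      (* The union of a chain of subspaces is already a subspace; 0 is added for the case of an
         empty [F]. *)
      pose G := [set q | q = 0 \/ exists2 K, F K & K q].
      have Gs : is_subspace G.
        split; first by left.
        move=> k y z [->|[K FK Ky]] [->|[K' FK' Kz]].
        - by left; rewrite scaler0 addr0.
        - by right; exists K' => //; rewrite scaler0 add0r.
        - by right; exists K => //; rewrite addr0; apply: subspaceZ => //;
            exact: nest_subspace (NF _ FK).
        - have [KK|KK] := nest_total (NF _ FK) (NF _ FK').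
          + right; exists K' => //; apply: (nest_subspace (NF _ FK')).2 => //.
            exact: KK.
          + right; exists K => //; apply: (nest_subspace (NF _ FK)).2 => //.
            exact: KK.
      have FG : \bigcup_(K in F) K `<=` G by move=> y [K FK Ky]; right; exists K.
      move=> /(_ G (conj Gs FG)) [->|[K FK Kq]] /=.
        by rewrite subr0 ltW.
      rewrite leNgt; apply/negP => /ltW qc; apply: FK.2 => y; apply.
      split; first exact: NF.
      by exists (u - q) => //; rewrite subKr.
    apply: (@preimage_closed _ _ (fun q => rnorm (u - q)) [set r | c <= r]).
      move=> q _; apply: (@continuous_comp _ _ _ (fun q => u - q) (@rnorm R H)).
        by apply: cvgB => //; exact: cvg_cst.
      exact: rnorm_continuous.
    exact: closed_ge.
  apply: (PC (orthproj P u)).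
  exact: (orthproj_in u (nest_subspace NP) (nest_closed NP)).
Qed.

(* Equivalently, the rank one operator [z |-> inner z t *: s] leaves the nest
   invariant. *)
Definition nest_pair s t : Prop :=
  forall M, nest_set N M -> M s \/ forall m, M m -> inner m t = 0.

(** For a suitable [y], [s] is a multiple of the projection of [x (b y)] on [M], and [t] of the part
    of [b y] orthogonal to [P], with [M] and [P] from [nest_cut]. The constant [c] is fixed before
    [Z] and [e], so the construction can be iterated. *)
Lemma noncompact_nest_pair a x b (B : H -> H) :
  (forall y z, inner (b y) z = inner y (B z)) ->
  a * x * b \notin @compact_ideal _ _ N ->
  exists2 c : R, 0 < c & forall (Z : seq H) (e : R), 0 < e ->
    exists s t, [/\ nest_pair s t, rnorm s <= 2^-1, rnorm t <= 2^-1,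
      c <= rnorm (a s) /\ c <= rnorm (B t) &
      forall z, z \in Z -> rnorm (inner s z : R[i]^o) <= e /\
                           rnorm (inner t z : R[i]^o) <= e].
Proof.
move=> bB /noncompact_weakly_small[d d0 small].
have A0 := opnorm_ge0 a; have X0 := opnorm_ge0 x; have B0 := opnorm_ge0 b.
set A := opnorm a in A0; set X := opnorm x in X0; set Bb := opnorm b in B0.
have AX0 : 0 <= A * X by exact: mulr_ge0.
have XB0 : 0 <= X * Bb by exact: mulr_ge0.
(* Small enough that moving [v] by [X * c0] changes its image under [a] by at most [d / 2]. *)
pose c0 := d / 2 / (A * X + 1).
have c00 : 0 < c0 by rewrite !divr_gt0// ltr_wpDl.
have c0d : A * (X * c0) <= d / 2.
  by rewrite mulrA mulrCA ler_piMr ?divr_ge0 ?(ltW d0)// ler_pdivrMr ?ltr_wpDl//;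
    lra.
pose q := X * Bb + Bb + 1; have q0 : 0 < q by rewrite /q; lra.
(* The factor [l] brings vectors of norm at most [q], such as [u] and [v] below, into the ball of
   radius [2^-1]. *)
pose l := (2 * q)^-1; have l0 : 0 < l by rewrite invr_gt0 mulr_gt0.
have lq : l * q = 2^-1 by rewrite /l invfM -mulrA mulVf ?mulr1// gt_eqF.
have l1 : l <= 1.
  by rewrite invf_le1 ?mulr_gt0// /q; lra.
exists (Num.min (l * (d / 2)) (l * c0 ^+ 2)).
  by rewrite lt_min; apply/andP; split; apply: mulr_gt0 => //;
    [exact: divr_gt0|exact: exprn_gt0].
move=> Z e e0.
have e20 : 0 < e / 2 by rewrite divr_gt0.
have [Y [r [r0 Ysmall]]] := nest_orthproj_uniformly_small N Z (ltW q0) e20.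
have m0 : 0 < Num.min r (e / 2) by rewrite lt_min r0.
(* Smallness against [Y] controls the pairings with every projection of a member of [Z]; smallness
   against [Z] itself handles the unprojected [u]. *)
have [y [y1 dy ysmall]] := small
  ([seq (x * b, z) | z <- Y ++ Z] ++ [seq (b, z) | z <- Y ++ Z]) _ m0.
pose u := b y; pose v := x u.
have uB : rnorm u <= Bb.
  by apply: le_trans (rnorm_opnorm b y) _; rewrite ler_piMr.
have vB : rnorm v <= X * Bb.
  by apply: le_trans (rnorm_opnorm x u) _; rewrite ler_wpM2l.
have smallw w z : w = u \/ w = v -> z \in Y ++ Z ->
    rnorm (inner w z : R[i]^o) <= Num.min r (e / 2).
  move=> [] -> zYZ.
    by apply: (ysmall (b, z)); rewrite mem_cat map_f ?orbT.
  by apply: (ysmall (x * b, z)); rewrite mem_cat map_f.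
have projw w z M : w = u \/ w = v -> z \in Z -> nest_set N M ->
    rnorm (inner w (orthproj M z) : R[i]^o) <= e / 2.
  move=> wuv zZ NM; apply: Ysmall => //.
    by case: wuv => ->; rewrite /q; lra.
  move=> y' y'Y; have := smallw w y' wuv; rewrite mem_cat y'Y => /(_ isT).
  by rewrite le_min => /andP[].
have dav : d <= rnorm (a v) by [].
have c0u : c0 < rnorm u.
  rewrite ltNge; apply/negP => uc0.
  have : rnorm (a v) <= A * (X * c0).
    apply: le_trans (rnorm_opnorm a v) _; rewrite ler_wpM2l//.
    by apply: le_trans (rnorm_opnorm x u) _; rewrite ler_wpM2l.
  lra.
have [M [P [NM NP MP vM uP]]] := nest_cut x (ltW c00) c0u.
have Ms := nest_subspace NM; have Mc := nest_closed NM.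
have Ps := nest_subspace NP; have Pc := nest_closed NP.
rewrite -/v -/X in vM.
exists (l%:C *: orthproj M v), (l%:C *: (u - orthproj P u)).
have nl : `|l| = l by rewrite gtr0_norm.
split.
(* A member containing [M] contains [s]; any other lies in [P], to which [t] is orthogonal. *)
- move=> K NK; have [MK|KP] := MP _ NK; [left|right].
    apply: subspaceZ; first exact: nest_subspace NK.
    by apply: MK; exact: orthproj_in.
  move=> m Km; rewrite innerZr innerC orthproj_orth ?rmorph0 ?mulr0//.
  exact: KP.
- rewrite rnormZ rnorm_real nl -lq ler_pM2l//.
  have := rnorm_orthproj v Ms Mc; rewrite /q; lra.
- rewrite rnormZ rnorm_real nl -lq ler_pM2l//.
  have := rnorm_orthproj_compl u Ps Pc; rewrite /q; lra.
- split; rewrite ge_min; apply/orP; [left|right].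
    rewrite linearZ /= rnormZ rnorm_real nl ler_pM2l//.
    have := rnormD (a (orthproj M v)) (a (v - orthproj M v)).
    rewrite -linearD addrC subrK.
    have : rnorm (a (v - orthproj M v)) <= A * (X * c0).
      by apply: le_trans (rnorm_opnorm a _) _; rewrite ler_wpM2l.
    lra.
  (* Pairing [B t] with [y], of norm at most 1, gives [l] times the squared norm of
     [u - orthproj P u], which is at least [c0 ^+ 2]. *)
  set t := _ *: _; apply: (@le_trans _ _ (rnorm (inner y (B t) : R[i]^o))).
    rewrite -bB -/u innerZr (rnormM _ (inner _ _)) rnorm_conj rnorm_real nl.
    rewrite ler_pM2l// -{1}(subrK (orthproj P u) u) innerDl inner_rnorm.
    rewrite [inner (orthproj P u) _]innerC orthproj_orth//; last exact: orthproj_in.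
    rewrite rmorph0 addr0 rnorm_real ger0_norm ?sqr_ge0//.
    by rewrite ler_sqr ?nnegrE ?rnorm_ge0// ltW.
  apply: le_trans (cauchy_schwarz _ _) _.
  by rewrite ler_piMl ?rnorm_ge0.
- move=> z zZ; rewrite !innerZl !(rnormM l%:C) rnorm_real nl.
  have zYZ : z \in Y ++ Z by rewrite mem_cat zZ orbT.
  have h1 := projw v z M (or_intror erefl) zZ NM.
  have h2 := projw u z P (or_introl erefl) zZ NP.
  have := smallw u z (or_introl erefl) zYZ; rewrite le_min => /andP[_ h3].
  split.
    rewrite inner_orthprojC// -[leRHS]mul1r.
    by apply: ler_pM; rewrite ?rnorm_ge0 ?(ltW l0)//; lra.
  rewrite innerBl inner_orthprojC// -[leRHS]mul1r.
  apply: ler_pM; rewrite ?rnorm_ge0 ?(ltW l0)//.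
  by apply: le_trans (rnormB _ _) _; rewrite [leRHS]splitr lerD.
Qed.

End rank_one.

(** * Continuity, limits, sums and recursive choice *)

Lemma linear_rnorm_continuous {R : realType} {V W : normedModType R[i]}
    (f : V -> W) (C : R) : linear f ->
  (forall x, rnorm (f x) <= C * rnorm x) -> continuous f.
Proof.
move=> fl fC x; apply/cvg_rnormP => e e0.
have C0 : 0 < `|C| + 1 by rewrite ltr_wpDl.
have d0 : 0 < e / (`|C| + 1) by rewrite divr_gt0.
have := (cvg_rnormP id x (nbhs_filter x)).1 cvg_id _ d0; apply: filterS => y.
have -> : f x - f y = f (x - y).
  by rewrite (addrC x) (addrC (f x)); have := fl (-1) y x; rewrite !scaleN1r.
rewrite ler_pdivlMr// => xy; apply: le_trans (fC _) (le_trans _ xy).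
rewrite mulrC ler_wpM2l ?rnorm_ge0//.
by apply: le_trans (ler_norm _) _; rewrite lerDl.
Qed.

Lemma closed_cball {R : realType} {V : normedModType R[i]} (x : V) (r : R) :
  closed [set y | rnorm (y - x) <= r].
Proof.
apply: (@preimage_closed _ _ (fun y => rnorm (y - x)) [set c | c <= r]).
  move=> y _; apply: (@continuous_comp _ _ _ (fun y => y - x) (@rnorm R V)).
    by apply: cvgB => //; exact: cvg_cst.
  exact: rnorm_continuous.
exact: closed_le.
Qed.

Lemma cvg_rnorm_le {R : realType} {V : normedModType R[i]} (T : Type)
    (F : set_system T) (u : T -> V) (l x : V) (r : R) : ProperFilter F ->
  u @ F --> l -> (\forall n \near F, rnorm (u n - x) <= r) -> rnorm (l - x) <= r.
Proof. by move=> FF ul ur;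
exact: (closed_cvg _ (@closed_cball _ _ x r) ur _ ul). Qed.

Lemma rnorm_sum {R : realType} {V : normedModType R[i]} (I : Type) (r : seq I)
    (P : pred I) (F : I -> V) :
  rnorm (\sum_(i <- r | P i) F i) <= \sum_(i <- r | P i) rnorm (F i).
Proof.
elim/big_ind2: _ => [|x a y b xa yb|//]; first by rewrite rnorm0.
exact: le_trans (rnormD _ _) (lerD _ _).
Qed.

(** Each term may depend on all earlier ones: [hist] accumulates the list of values chosen so
    far. *)
Lemma dependent_choice_seq (U : Type) (P : seq U -> U -> Prop) :
  (forall l, exists u, P l u) -> exists f : nat -> U, forall n, P (mkseq f n) (f n).
Proof.
move=> /choice[g gP].
pose hist := fix hist n := if n is m.+1 then rcons (hist m) (g (hist m)) else [::].
exists (fun n => g (hist n)) => n.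
suff -> : mkseq (fun n => g (hist n)) n = hist n by exact: gP.
elim: n => // n IHn.
by rewrite -[in LHS]addn1 /mkseq iotaD map_cat /= -/(mkseq _ n) IHn cats1.
Qed.

Lemma sum_half_le1 {R : realType} m n : \sum_(m <= k < n) (2^-1 : R) ^+ k.+1 <= 1.
Proof.
have [mn|nm] := leqP m n; last by rewrite big_geq// ltnW.
rewrite (eq_bigr (fun k => - (2^-1) ^+ k.+1 - - (2^-1) ^+ k)); last first.
  by move=> k _; rewrite exprS; set q := _ ^+ k; lra.
rewrite telescope_sumr//.
have : (2^-1 : R) ^+ m <= 1 by rewrite exprn_ile1 ?invr_ge0// invf_le1 ?ler1n.
have : 0 <= (2^-1 : R) ^+ n by rewrite exprn_ge0 ?invr_ge0.
lra.
Qed.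

(** * Almost orthogonal sequences and their rank one series *)

Section almost_orthogonal.
Context {R : realType} {H : hilbertType R}.
Implicit Types (s t : nat -> H) (x y z : H).

(** The hypothesis of the Schur test: uniformly bounded absolute row sums of the Gram matrix. *)
Definition almost_orthogonal (K : R) s : Prop := forall m n j,
  \sum_(m <= k < n) rnorm (inner (s j) (s k) : R[i]^o) <= K.

Lemma rnorm_innerC x y : rnorm (inner x y : R[i]^o) = rnorm (inner y x : R[i]^o).
Proof. by rewrite innerC rnorm_conj. Qed.

Lemma almost_orthogonal_of_decay s (D : R) : 0 <= D ->
  (forall j k, rnorm (inner (s j) (s k) : R[i]^o) <=
     (if j == k then D else 0) + 2^-1 ^+ j.+1 * 2^-1 ^+ k.+1) ->
  almost_orthogonal (D + 2^-1) s.
Proof.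
move=> D0 sD m n j; apply: le_trans (ler_sum _ (fun k _ => sD j k)) _.
rewrite big_split /= lerD//.
  rewrite -big_mkcond /= (eq_bigl (pred1 j)) => [|k]; last exact: eq_sym.
  by rewrite big_nat1_eq; case: ifP.
rewrite -mulr_sumr; apply: (@le_trans _ _ (2^-1 * 1)); last by rewrite mulr1.
apply: ler_pM.
- by rewrite exprn_ge0 ?invr_ge0.
- by apply: sumr_ge0 => k _; rewrite exprn_ge0 ?invr_ge0.
- by rewrite exprS ler_piMr ?invr_ge0// exprn_ile1 ?invr_ge0// invf_le1 ?ler1n.
- exact: sum_half_le1.
Qed.

(* Schur test for the Gram matrix of [s]. *)
Lemma almost_orthogonal_sum K s (c : nat -> R[i]) m n :
  almost_orthogonal K s ->
  rnorm (\sum_(m <= k < n) c k *: s k) ^+ 2 <=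
    K * \sum_(m <= k < n) rnorm (c k : R[i]^o) ^+ 2.
Proof.
move=> sK; set w := \sum_(m <= k < n) _.
pose g j k := rnorm (inner (s j) (s k) : R[i]^o).
pose d k := rnorm (c k : R[i]^o).
have -> : rnorm w ^+ 2 = rnorm (inner w w : R[i]^o).
  by rewrite inner_rnorm rnorm_real ger0_norm ?sqr_ge0.
apply: (@le_trans _ _ (\sum_(m <= j < n) \sum_(m <= k < n) d j * d k * g j k)).
  rewrite {1}/w inner_suml; apply: le_trans (@rnorm_sum R R[i]^o _ _ _ _) _.
  apply: ler_sum => j _; rewrite rnorm_innerC /w inner_suml.
  apply: le_trans (@rnorm_sum R R[i]^o _ _ _ _) _; apply: ler_sum => k _.
  rewrite innerZl innerZr !(@rnormM R (_ : R[i]^o)) rnorm_conj -/(d j) -/(d k).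
  by rewrite rnorm_innerC -/(g j k) mulrA (mulrC (d k)).
(* [d j * d k] is at most the mean of the squares; by symmetry of [g] both halves have the same
   sum. *)
apply: (@le_trans _ _ (\sum_(m <= j < n) \sum_(m <= k < n)
    (d j ^+ 2 * g j k / 2 + d k ^+ 2 * g j k / 2))).
  apply: ler_sum => j _; apply: ler_sum => k _.
  have := sqr_ge0 (d j - d k); have : 0 <= g j k := rnorm_ge0 _; nra.
rewrite (eq_bigr _ (fun j _ => big_split _ _ _ _ _)) /= big_split /=.
rewrite [X in _ + X]exchange_big /=.
have gC j k : g j k = g k j by exact: rnorm_innerC.
under [X in _ + X]eq_bigr do under eq_bigr do rewrite gC.
rewrite -mulr2n -[leLHS]mulr_natl !mulr_sumr; apply: ler_sum => j _.
rewrite mulr_sumr (eq_bigr (fun k => d j ^+ 2 * g j k)) => [|k _]; last by field.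
by rewrite -mulr_sumr mulrC ler_wpM2r ?sqr_ge0//; exact: sK.
Qed.

(** Dual to [almost_orthogonal_sum]: with the coefficients [inner z (s k)], the sum [w] satisfies
    [rinner w z = Q], so [Q ^+ 2 <= K * Q * rnorm z ^+ 2], and a factor [Q] cancels. *)
Lemma almost_orthogonal_bessel K s z m n : 0 <= K -> almost_orthogonal K s ->
  \sum_(m <= k < n) rnorm (inner z (s k) : R[i]^o) ^+ 2 <= K * rnorm z ^+ 2.
Proof.
move=> K0 sK; have := almost_orthogonal_sum (fun k => inner z (s k)) m n sK.
set w := \sum_(m <= k < n) _; set Q := \sum_(m <= k < n) _ => wQ.
have Q0 : 0 <= Q by apply: sumr_ge0 => k _; exact: sqr_ge0.
have QE : rinner w z = Q.
  rewrite /rinner /w inner_suml raddf_sum; apply: eq_bigr => k _ /=.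
  rewrite innerZl [inner (s k) z]innerC rnorm_sqr; case: (inner _ _) => p q /=.
  by rewrite mulrN opprK !expr2.
have := rinner_le w z; rewrite QE => Qwz.
have [->|Qn0] := eqVneq Q 0; first by rewrite mulr_ge0 ?sqr_ge0.
have Qgt0 : 0 < Q by rewrite lt_neqAle eq_sym Qn0.
rewrite -(ler_pM2l Qgt0) -expr2.
apply: (@le_trans _ _ ((rnorm w * rnorm z) ^+ 2)).
  by rewrite ler_sqr ?nnegrE// mulr_ge0 ?rnorm_ge0.
by rewrite exprMn [leRHS]mulrCA [leRHS]mulrA ler_wpM2r ?sqr_ge0.
Qed.

Lemma almost_orthogonal_partial_sums K s z n : 0 <= K -> almost_orthogonal K s ->
  series (fun k => rnorm (inner z (s k) : R[i]^o) ^+ 2) n <= K * rnorm z ^+ 2.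
Proof. by move=> K0 sK; exact: almost_orthogonal_bessel. Qed.

Lemma almost_orthogonal_is_cvg K s z : 0 <= K -> almost_orthogonal K s ->
  cvgn (series (fun k => rnorm (inner z (s k) : R[i]^o) ^+ 2)).
Proof.
move=> K0 sK; apply: nondecreasing_is_cvgn.
  by apply: nondecreasing_series => k _ _; exact: sqr_ge0.
exists (K * rnorm z ^+ 2) => _ [n _ <-].
exact: almost_orthogonal_partial_sums.
Qed.

Lemma almost_orthogonal_weakly_null K s z : 0 <= K -> almost_orthogonal K s ->
  (fun n => inner z (s n) : R[i]^o) @ \oo --> (0 : R[i]^o).
Proof.
move=> K0 sK; have /cvg_series_cvg_0 := almost_orthogonal_is_cvg (z := z) K0 sK.
move=> /cvgrPdist_le h; apply/cvg_rnormP => e e0.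
have := h (e ^+ 2) (exprn_gt0 _ e0); apply: filterS => n.
rewrite !sub0r normrN rnormN ger0_norm ?sqr_ge0//.
by rewrite ler_sqr ?nnegrE ?rnorm_ge0// ltW.
Qed.

End almost_orthogonal.

(** Bessel for [t] and the Schur bound for [s] make the partial sums Cauchy and bounded by
    [K * rnorm z]. Each term leaves every member of the nest invariant, and members are closed, so
    the limit does too. *)
Lemma nest_series {R : realType} {H : hilbertType R} (N : nest H) (K : R)
    (s t : nat -> H) (A : pred nat) : 0 <= K -> almost_orthogonal K s ->
  almost_orthogonal K t -> (forall k, nest_pair N (s k) (t k)) ->
  exists T : nestalg N, opnorm T <= K /\ forall z,
    (fun n => \sum_(0 <= k < n | A k) inner z (t k) *: s k) @ \oo --> T z.
Proof.
move=> K0 sK tK stN.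
pose c z k : R[i] := if A k then inner z (t k) else 0.
pose X z n := \sum_(0 <= k < n) c z k *: s k.
have XE z n : X z n = \sum_(0 <= k < n | A k) inner z (t k) *: s k.
  rewrite [RHS]big_mkcond; apply: eq_bigr => k _; rewrite /c.
  by case: ifP => // _; rewrite scale0r.
have cle z k : rnorm (c z k : R[i]^o) ^+ 2 <= rnorm (inner z (t k) : R[i]^o) ^+ 2.
  by rewrite /c; case: ifP => // _; rewrite rnorm0 expr0n /= sqr_ge0.
have Xcvg z : cvg (X z @ \oo).
  apply: rnorm_cauchy_cvg => e e0.
  have e20 : 0 < e ^+ 2 / (2 * (K + 1)).
    by rewrite divr_gt0 ?exprn_gt0 ?mulr_gt0 ?ltr_wpDl.
  have /cvg_ex[/= l /cvgrPdist_le/(_ _ e20)[n0 _ hl]] :=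
    almost_orthogonal_is_cvg (z := z) K0 tK.
  exists (X z n0), n0 => // n /= n0n.
  rewrite rnormC /X (big_cat_nat _ n0n)//= addrAC subrr add0r.
  rewrite -ler_sqr ?nnegrE ?rnorm_ge0 ?(ltW e0)//.
  apply: le_trans (almost_orthogonal_sum _ _ _ sK) _.
  apply: (@le_trans _ _ (K * (e ^+ 2 / (K + 1)))); last first.
    by rewrite mulrCA ler_piMr ?sqr_ge0// ler_pdivrMr ?ltr_wpDl//; lra.
  rewrite ler_wpM2l//; apply: le_trans (ler_sum _ (fun k _ => cle z k)) _.
  have := hl _ (leqnn n0); have := hl _ n0n; rewrite /series/= /series/=.
  rewrite (big_cat_nat _ n0n)//= !ler_norml => /andP[h1 h2] /andP[h3 h4].
  have -> : e ^+ 2 / (K + 1) = 2 * (e ^+ 2 / (2 * (K + 1))).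
    by field; rewrite gt_eqF ?ltr_wpDl.
  move: h1 h2 h3 h4; lra.
pose Tf z := lim (X z @ \oo).
have XT z : X z @ \oo --> Tf z by exact: Xcvg.
have Tl : linear Tf.
  move=> k y z; apply: cvg_lim; first exact: norm_hausdorff.
  have -> : X (k *: y + z) = (fun n => k *: X y n + X z n).
    apply/funext => n; rewrite /X scaler_sumr -big_split /=.
    apply: eq_bigr => i _; rewrite scalerA -scalerDl; congr (_ *: _).
    by rewrite /c; case: ifP => _; rewrite ?innerDl ?innerZl// mulr0 addr0.
  by apply: cvgD => //; apply: cvgZr.
have TK z : rnorm (Tf z) <= K * rnorm z.
  rewrite -[Tf z]subr0; apply: (cvg_rnorm_le _ (XT z)); apply: nearW => n.
  rewrite subr0 -ler_sqr ?nnegrE ?mulr_ge0 ?rnorm_ge0// exprMn [K ^+ 2]expr2.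
  apply: le_trans (almost_orthogonal_sum _ _ _ sK) _; rewrite -mulrA.
  rewrite ler_wpM2l//; apply: le_trans (ler_sum _ (fun k _ => cle z k)) _.
  exact: almost_orthogonal_bessel.
have Talg : Tf \in nestalg_pred N.
  apply/nestalgP; split => //; first exact: linear_rnorm_continuous TK.
  move=> M NM z Mz.
  apply: (@closed_cvg _ _ \oo _ (X z) M (nest_closed NM) _ _ (XT z)).
  apply: nearW => n; have Ms := nest_subspace NM.
  apply: (big_ind M); [exact: Ms.1|by move=> ? ?; exact: subspaceD|].
  move=> k _; have [Msk|Mt] := stN k M NM; first exact: subspaceZ.
  by rewrite /c Mt// if_same scale0r; exact: Ms.1.
exists (NestAlg Talg); split.
  by apply: opnorm_le => z z1; rewrite rnorm_le; apply: le_trans (TK z) _;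
    rewrite ler_piMr// -rnorm_le.
by move=> z; under eq_fun do rewrite -XE; exact: XT.
Qed.

(** * Block operators with almost diagonal images *)

Section blocks.
Context {R : realType} {H : hilbertType R} (N : nest H).
Implicit Types (a b x T S : nestalg N).

(* The [T] attached to [A] is the sum over [k] in [A] of the rank one operators of
   an almost orthogonal sequence of nest pairs [(s k, t k)], with [p k = b^* (t k)]
   and [q k = a (s k)]. *)
Lemma noncompact_nest_blocks a x b : a * x * b \notin @compact_ideal _ _ N ->
  exists (p q : nat -> H) (c E : R), [/\ 0 < c, forall k, rnorm (p k) <= E,
    forall k, rnorm (q k) <= E,
    forall z, (fun k => inner z (q k) : R[i]^o) @ \oo --> (0 : R[i]^o) &
    forall A : pred nat, exists2 T : nestalg N, opnorm T <= 1 & forall j,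
      let w := inner (a (T (b (p j)))) (q j) : R[i]^o in
      if A j then c - 2^-1 ^+ j <= complex.Re w else rnorm w <= 2^-1 ^+ j].
Proof.
move=> axb; have [B bB] := adjoint_ex b; have [A' aA] := adjoint_ex a.
have [c c0 pairs] := noncompact_nest_pair bB axb.
(* Near orthogonality to these vectors makes [s], [t], [a (s k)] and [B (t k)] almost orthogonal,
   the last two through the adjoint relations. *)
pose Z (l : seq (H * H)) := flatten
  [seq [:: y.1; y.2; A' (a y.1); b (B y.2)] | y <- l].
pose h (k : nat) : R := 2^-1 ^+ k.+1.
have h0 k : 0 < h k by rewrite exprn_gt0 ?invr_gt0.
pose P (l : seq (H * H)) (y : H * H) := [/\ nest_pair N y.1 y.2,
  rnorm y.1 <= 2^-1, rnorm y.2 <= 2^-1, c <= rnorm (a y.1) /\ c <= rnorm (B y.2) &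
  forall z, z \in Z l -> rnorm (inner y.1 z : R[i]^o) <= h (size l) ^+ 2 /\
                         rnorm (inner y.2 z : R[i]^o) <= h (size l) ^+ 2].
have [|f fP] := @dependent_choice_seq _ P.
  move=> l; have [s [t st]] := pairs (Z l) _ (exprn_gt0 2 (h0 (size l))).
  by exists (s, t).
pose s k := (f k).1; pose t k := (f k).2.
have stN k : nest_pair N (s k) (t k) by case: (fP k).
have s2 k : rnorm (s k) <= 2^-1 by case: (fP k).
have t2 k : rnorm (t k) <= 2^-1 by case: (fP k).
have asc k : c <= rnorm (a (s k)) by case: (fP k) => _ _ _ [].
have Btc k : c <= rnorm (B (t k)) by case: (fP k) => _ _ _ [].
(* The tolerance for term [k] is [h k ^+ 2]; as [h] decreases, it is below the product required by
   [almost_orthogonal_of_decay]. *)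
have hh j k : (j < k)%N -> h k ^+ 2 <= h j * h k.
  move=> jk; rewrite expr2 ler_pM2r// /h ler_wiXn2l ?invr_ge0//.
    by rewrite invf_le1 ?ler1n.
  exact: ltnW.
have small k j z : (j < k)%N -> z \in [:: s j; t j; A' (a (s j)); b (B (t j))] ->
    rnorm (inner (s k) z : R[i]^o) <= h j * h k /\
    rnorm (inner (t k) z : R[i]^o) <= h j * h k.
  move=> jk zj; have [_ _ _ _ /(_ z)] := fP k; rewrite size_mkseq => zP.
  have [|h1 h2] := zP.
    apply/flattenP; exists [:: s j; t j; A' (a (s j)); b (B (t j))] => //.
    by apply/mapP; exists (f j) => //; apply/mapP; exists j => //; rewrite mem_iota.
  by split; [apply: le_trans h1 _|apply: le_trans h2 _]; exact: hh.
have decay (g : nat -> H) D : 0 <= D -> (forall k, rnorm (g k) ^+ 2 <= D) ->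
    (forall j k, (j < k)%N -> rnorm (inner (g k) (g j) : R[i]^o) <= h j * h k) ->
    forall j k, rnorm (inner (g j) (g k) : R[i]^o) <=
      (if j == k then D else 0) + h j * h k.
  move=> D0 gD gh j k; case: ltngtP => [jk|kj|->].
  - by rewrite add0r rnorm_innerC; exact: gh.
  - by rewrite add0r mulrC; exact: gh.
  - rewrite inner_rnorm rnorm_real ger0_norm ?sqr_ge0//.
    by rewrite -[leLHS]addr0 lerD// mulr_ge0 ?(ltW (h0 _)).
have sd j k : (j < k)%N -> rnorm (inner (s k) (s j) : R[i]^o) <= h j * h k.
  by move=> jk; apply: (small _ _ _ jk _).1; rewrite !inE eqxx.
have td j k : (j < k)%N -> rnorm (inner (t k) (t j) : R[i]^o) <= h j * h k.
  by move=> jk; apply: (small _ _ _ jk _).2; rewrite !inE eqxx orbT.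
have asd j k : (j < k)%N -> rnorm (inner (a (s k)) (a (s j)) : R[i]^o) <= h j * h k.
  by move=> jk; rewrite aA; apply: (small _ _ _ jk _).1; rewrite !inE eqxx !orbT.
have Btd j k : (j < k)%N -> rnorm (inner (B (t k)) (B (t j)) : R[i]^o) <= h j * h k.
  move=> jk; rewrite rnorm_innerC -bB rnorm_innerC.
  by apply: (small _ _ _ jk _).2; rewrite !inE eqxx !orbT.
have half2 (y : H) : rnorm y <= 2^-1 -> rnorm y ^+ 2 <= 4^-1 :> R.
  by move=> ?; have := rnorm_ge0 y; nra.
(* The radius [2^-1] bounds the diagonal by [4^-1], and [4^-1 + 2^-1 <= 1]. *)
have sO : almost_orthogonal 1 s.
  move=> m n j; have q0 : 0 <= 4^-1 :> R by rewrite invr_ge0.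
  have := almost_orthogonal_of_decay q0 (decay s _ q0 (fun k => half2 _ (s2 k)) sd).
  by move=> /(_ m n j) /le_trans; apply; lra.
have tO : almost_orthogonal 1 t.
  move=> m n j; have q0 : 0 <= 4^-1 :> R by rewrite invr_ge0.
  have := almost_orthogonal_of_decay q0 (decay t _ q0 (fun k => half2 _ (t2 k)) td).
  by move=> /(_ m n j) /le_trans; apply; lra.
have as_le k : rnorm (a (s k)) <= opnorm a.
  apply: le_trans (rnorm_opnorm _ _) _; rewrite ler_piMr ?opnorm_ge0//.
  by apply: le_trans (s2 k) _; lra.
have Bt_le k : rnorm (B (t k)) <= opnorm b.
  have [->|Bt0] := eqVneq (rnorm (B (t k))) 0; first exact: opnorm_ge0.
  have Btp : 0 < rnorm (B (t k)) by rewrite lt_neqAle eq_sym Bt0 rnorm_ge0.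
  rewrite -(ler_pM2r Btp) -expr2 -rinner_rnorm /rinner -bB.
  apply: le_trans (rinner_le _ _) _.
  apply: (@le_trans _ _ (rnorm (b (B (t k))) * 1)).
    by rewrite ler_wpM2l ?rnorm_ge0//; apply: le_trans (t2 k) _; lra.
  by rewrite mulr1; exact: rnorm_opnorm.
have a2 : 0 <= opnorm a ^+ 2 by exact: sqr_ge0.
have asO : almost_orthogonal (opnorm a ^+ 2 + 2^-1) (fun k => a (s k)).
  apply: almost_orthogonal_of_decay => //; apply: decay => // k.
  by rewrite ler_sqr ?nnegrE ?rnorm_ge0 ?opnorm_ge0.
have K0 : 0 <= opnorm a ^+ 2 + 2^-1 :> R by rewrite addr_ge0 ?invr_ge0.
exists (fun k => B (t k)), (fun k => a (s k)), (c ^+ 2 * c ^+ 2),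
  (opnorm a + opnorm b).
have a0 := opnorm_ge0 a; have b0 := opnorm_ge0 b; split.
- by rewrite mulr_gt0 ?exprn_gt0.
- by move=> k; have := Bt_le k; lra.
- by move=> k; have := as_le k; lra.
- by move=> z; exact: almost_orthogonal_weakly_null K0 asO.
move=> A; have [T [T1 TE]] := nest_series A ler01 sO tO stN.
exists T; first exact: T1.
move=> j; cbv zeta; set w : R[i]^o := inner _ _.
pose gt k : R[i]^o := inner (B (t j)) (B (t k)).
pose gs k : R[i]^o := inner (a (s k)) (a (s j)).
(* The coefficient [w] is the sum of [gt k * gs k] over [A]. Its diagonal term [dj] is at least
   [c ^+ 2 * c ^+ 2] when [j] is in [A], and the other terms add up to at most [2^-1 ^+ j]. *)
pose dj : R[i]^o := if A j then gt j * gs j else 0.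
have wlim : (fun n => \sum_(0 <= k < n | A k) gt k * gs k : R[i]^o) @ \oo --> w.
  have -> : (fun n => \sum_(0 <= k < n | A k) gt k * gs k) =
      (fun n => inner (a (\sum_(0 <= k < n | A k) inner (b (B (t j))) (t k) *: s k))
                      (a (s j)) : R[i]^o).
    apply/funext => n; rewrite linear_sum inner_suml; apply: eq_bigr => k _.
    by rewrite linearZ /= innerZl bB.
  apply: (@cvg_comp _ _ _ _ (fun z => inner (a z) (a (s j)) : R[i]^o) _ _ _ (TE _)).
  apply: (@continuous_comp _ _ _ a (fun z => inner z (a (s j)) : R[i]^o)).
    exact: nestalg_continuous.
  exact: inner_continuousl.
have wd : rnorm (w - dj) <= 2^-1 ^+ j.
  apply: (cvg_rnorm_le _ wlim); exists j.+1 => // n /= jn.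
  have -> : \sum_(0 <= k < n | A k) gt k * gs k - dj =
      \sum_(0 <= k < n | A k && (k != j)) gt k * gs k.
    rewrite /dj; case: ifP => Aj.
      rewrite big_mkcond (bigD1_seq j) ?mem_index_iota ?iota_uniq//= Aj.
      rewrite addrAC subrr add0r -big_mkcondr.
      by apply: eq_bigl => k; rewrite andbC.
    rewrite subr0; apply: eq_bigl => k; case: eqP => [->|]; rewrite ?andbT//.
    by rewrite Aj.
  apply: le_trans (@rnorm_sum R R[i]^o _ _ _ _) _.
  apply: (@le_trans _ _ (\sum_(0 <= k < n) 2^-1 ^+ j * h k)); last first.
    by rewrite -mulr_sumr ler_piMr ?exprn_ge0 ?invr_ge0// sum_half_le1.
  rewrite big_mkcond; apply: ler_sum => k _.
  case: ifP => [/andP[_ kj]|_]; last by rewrite mulr_ge0 ?exprn_ge0 ?invr_ge0// ltW.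
  have hk1 i : h i <= 1 by rewrite exprn_ile1 ?invr_ge0// invf_le1 ?ler1n.
  have hj : h j <= 2^-1 ^+ j.
    by rewrite /h exprS ler_piMl ?exprn_ge0 ?invr_ge0// invf_le1 ?ler1n.
  have gth : rnorm (gt k) <= h j * h k.
    move: kj; rewrite /gt neq_ltn => /orP[kj|jk].
      by rewrite mulrC; exact: Btd.
    by rewrite rnorm_innerC; exact: Btd.
  have gsh : rnorm (gs k) <= h j * h k.
    move: kj; rewrite /gs neq_ltn => /orP[kj|jk]; last exact: asd.
    by rewrite mulrC rnorm_innerC; exact: asd.
  rewrite rnormM; apply: (@le_trans _ _ (h j * h k * 1)); last first.
    by rewrite mulr1 ler_pM2r.
  apply: ler_pM => //; rewrite ?rnorm_ge0//; apply: le_trans gsh _.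
  by rewrite mulr_ile1 ?(ltW (h0 _)).
move: wd; rewrite /dj; case: ifP => Aj; last by rewrite subr0.
have -> : gt j * gs j = (rnorm (B (t j)) ^+ 2 * rnorm (a (s j)) ^+ 2)%:C.
  by rewrite /gt /gs !inner_rnorm -rmorphM.
set r := _ * _ => wr; have rc : c ^+ 2 * c ^+ 2 <= r.
  by apply: ler_pM; rewrite ?sqr_ge0// ler_sqr ?nnegrE ?rnorm_ge0 ?(ltW c0).
have := le_trans (Re_le_rnorm _) wr; rewrite raddfB /= ler_norml => /andP[h1 _].
lra.
Qed.

End blocks.

(** * The weak topology and weak cluster points *)

Section weak_topology.
Context {K : numFieldType} {V : normedModType K}.

Lemma weak_continuous (f : dual V) : continuous (sval f : weak V -> K^o).
Proof.
move=> x A fA.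
have fx : nbhs (x : initial_topology (sval f : V -> K^o))
    ((sval f : V -> K^o) @^-1` A).
  exact: (@initial_continuous _ _ (sval f : V -> K^o) x A fA).
pose Ts (f : dual V) := Topological.on (initial_topology (sval f : V -> K^o)).
have h := (@cvg_sup V (dual V) Ts
  (@nbhs _ (weak V) x) x (@nbhs_filter (weak V) x)).1.
exact: (h (fun A => id) f _ fx).
Qed.

Lemma cvg_weak (F : set_system V) (x : V) : Filter F ->
  (forall f : dual V, (sval f : V -> K^o) @ F --> (sval f x : K^o)) ->
  F --> (x : weak V).
Proof.
move=> FF fF.
pose Ts (f : dual V) := Topological.on (initial_topology (sval f : V -> K^o)).
apply: (@cvg_sup V (dual V) Ts F x _).2 => f A [_ [[U Uo <-] Ufx] UA].
by apply: filterS UA _; apply: fF; exact: open_nbhs_nbhs.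
Qed.
Lemma weak_nbhs (f : dual V) (x : V) (e : K) : 0 < e ->
  nbhs (x : weak V) [set y | `|sval f x - sval f y : K^o| < e].
Proof.
move=> e0; have := @weak_continuous f x _ (nbhsx_ballx (sval f x : K^o) e e0).
by rewrite -ball_normE.
Qed.

(** All functionals vanish on the closure of [[set 0]], so its points are weakly indistinguishable
    from 0 and any filter on it clusters at 0. *)
Lemma weakly_precompact0 : precompact ([set 0] : set (weak V)).
Proof.
rewrite precompactE => F PF F0; exists (0 : weak V).
split; first exact: subset_closure.
move=> A B FA nB; have [y [Ay y0]] := filter_ex (filterI FA F0).
exists y; split=> //.
suff : globally [set y] --> (0 : weak V) by move=> /(_ B nB); apply.
apply: cvg_weak => f; apply/cvgrPdist_lt => e e0 _ ->.
by have [_ [-> ]] := y0 _ (weak_nbhs f y e0); rewrite /= distrC.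
Qed.

End weak_topology.

(** A cluster point of the image sequence, recorded as what a single functional sees of it:
    approximation at arbitrarily late indices. *)
Lemma weak_cluster_point {K : numFieldType} {V W : normedModType K}
    (T : {linear V -> W}) (u : nat -> V) : weakly_compact_operator T ->
  (forall n, `|u n| <= 1) ->
  exists z : W, forall (f : dual W) (e : K) (m : nat), 0 < e ->
    exists2 n, (m <= n)%N & `|sval f z - sval f (T (u n)) : K^o| < e.
Proof.
rewrite /weakly_compact_operator precompactE => cT u1.
pose Tu n : weak W := T (u n).
have [|z [_ clz]] := cT (Tu @ \oo) _.
  exists 0%N; first exact: I.
  by move=> n _; apply: subset_closure; exists (u n) => //; exact: u1.
exists z => f e m e0.
have Fm : (Tu @ \oo) [set Tu n | n in [set n | (m <= n)%N]].
  by exists m; [exact: I|move=> n mn; exists n].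
have [_ [[n /= mn <-] fn]] := clz _ _ Fm (weak_nbhs f z e0).
by exists n.
Qed.

(** * Functionals on the quotient from ultrafilter limits *)

Lemma cvg_Re_ge {R : realType} (T : Type) (F : set_system T) (u : T -> R[i]^o)
    (l : R[i]^o) (r : R) : ProperFilter F -> u @ F --> l ->
  (\forall n \near F, r <= complex.Re (u n)) -> r <= complex.Re l.
Proof.
move=> FF /cvg_rnormP ul ur; apply/ler_addgt0Pr => e /ul le.
have [n [rn nl]] := filter_ex (filterI ur le).
have := le_trans (Re_le_rnorm _) nl; rewrite raddfB /= ler_norml.
by move=> /andP[? _]; move: rn => /= rn; lra.
Qed.

(* Ultrafilter limits of matrix coefficients along a weakly null sequence kill
   the compact operators, hence are functionals on the quotient. *)
Lemma quot_functional {R : realType} {H : hilbertType R} (N : nest H)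
    (U : set_system nat) (p q : nat -> H) (E : R) :
  UltraFilter U -> \oo `<=` U ->
  (forall n, rnorm (p n) <= E) -> (forall n, rnorm (q n) <= E) ->
  (forall z, (fun n => inner z (q n) : R[i]^o) @ \oo --> (0 : R[i]^o)) ->
  exists f : dual (nestquot N), forall S : nestalg N,
    (fun n => inner (S (p n)) (q n) : R[i]^o) @ U --> (sval f (quot_map S) : R[i]^o).
Proof.
move=> UU ooU pE qE q0; have PU := @ultra_proper _ _ UU.
have E0 : 0 <= E by exact: le_trans (rnorm_ge0 _) (pE 0).
pose c (S : nestalg N) n : R[i]^o := inner (S (p n)) (q n).
have cE S n : rnorm (c S n) <= E ^+ 2 * opnorm S.
  apply: le_trans (cauchy_schwarz _ _) _.
  rewrite expr2 mulrAC; apply: ler_pM; rewrite ?rnorm_ge0//.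
  by apply: le_trans (rnorm_opnorm _ _) _; rewrite mulrC ler_wpM2r ?opnorm_ge0.
pose L S : R[i]^o := lim (c S @ U).
have cL S : c S @ U --> L S by exact: complex_bounded_cvg (cE S).
have Luniq S l : c S @ U --> l -> L S = l.
  by move=> Sl; apply: cvg_lim => //; exact: norm_hausdorff.
have LP k S T : L (k *: S + T) = k *: L S + L T.
  apply: Luniq; have -> : c (k *: S + T) = (fun n => k *: c S n + c T n).
    by apply/funext => n; rewrite /c !nestalgE innerDl innerZl.
  by apply: cvgD => //; apply: cvgZr.
have LE S : rnorm (L S) <= E ^+ 2 * opnorm S.
  by rewrite -[L S]subr0; apply: (cvg_rnorm_le _ (cL S)); apply: nearW => n;
    rewrite subr0.
have LK S : S \in @compact_ideal _ _ N -> L S = 0.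
  move=> /compact_idealP; rewrite /compact_operator precompactE compact_ultra => cS.
  (* Dividing [p n] by [k] puts it in the unit ball; [k] is positive even for [E = 0]. *)
  apply: Luniq; pose k := E + 1; have k0 : 0 < k by rewrite ltr_wpDl.
  pose y n := S ((k^-1)%:C *: p n).
  have [|l [_ yl]] := cS (y @ U) (fmap_ultra y UU).
    apply: nearW => n; apply: subset_closure; exists ((k^-1)%:C *: p n) => //.
    rewrite /unit_ball /= (rnorm_le _ 1) rnormZ rnorm_real gtr0_norm ?invr_gt0//.
    by rewrite ler_pdivrMl// mulr1; apply: le_trans (pE n) _; rewrite lerDl.
  apply/cvg_rnormP => e e0.
  have d0 : 0 < e / (2 * k ^+ 2) by rewrite divr_gt0 ?mulr_gt0 ?exprn_gt0.
  have e2 : 0 < e / (2 * k) by rewrite divr_gt0 ?mulr_gt0.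
  have /cvg_rnormP/(_ _ d0) yU := yl.
  have /cvg_rnormP/(_ _ e2) lq := q0 l.
  have {}lq : U [set n | rnorm (0 - inner l (q n) : R[i]^o) <= e / (2 * k)].
    exact: ooU.
  (* The coefficient splits into a part controlled by [y n - l] and the pairing of the fixed [l]
     with the weakly null [q n]. *)
  apply: filterS2 yU lq => n; rewrite sub0r rnormN rnormC => yn ln.
  have -> : c S n = k%:C * inner (y n - l + l) (q n).
    rewrite subrK /y linearZ /= innerZl mulrA -rmorphM /= divff ?mul1r//.
    by rewrite gt_eqF.
  rewrite innerDl (rnormM k%:C) rnorm_real gtr0_norm//.
  have h1 : rnorm (inner (y n - l) (q n) : R[i]^o) <= e / (2 * k).
    apply: le_trans (cauchy_schwarz _ _) _.
    have -> : e / (2 * k) = e / (2 * k ^+ 2) * k.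
      by field; rewrite gt_eqF.
    apply: ler_pM; rewrite ?rnorm_ge0//; apply: le_trans (qE n) _.
    by rewrite lerDl.
  rewrite -ler_pdivlMl// mulrC; apply: le_trans (rnormD _ _) _.
  have -> : e / k = e / (2 * k) + e / (2 * k) by field; rewrite gt_eqF.
  by apply: lerD => //; move: ln; rewrite /= sub0r rnormN.
(* The choice of representative is harmless, since [L] is additive and vanishes on compact
   operators. *)
pose f (x : nestquot N) : R[i]^o := L (repr x).
have fE S : f (quot_map S) = L S.
  have := LP (-1) (repr (quot_map S)) S; rewrite !scaleN1r addrC.
  rewrite (LK (S - repr (quot_map S))); last exact: repr_quot_map.
  by move/esym/eqP; rewrite addrC subr_eq0 => /eqP.
have fl : linear f.
  move=> k x y; case: (quot_map_surj x) (quot_map_surj y) => [S <-] [T <-].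
  by rewrite -linearP !fE LP.
have fb x : rnorm (f x) <= E ^+ 2 * rnorm x.
  apply/ler_addgt0Pr => e e0; have E20 := sqr_ge0 E.
  have d0 : 0 < e / (E ^+ 2 + 1) by rewrite divr_gt0// ltr_wpDl.
  (* A representative of nearly minimal norm transfers the bound on [L] to the quotient norm. *)
  have [S <- Sx] := quot_norm_adherent x d0.
  rewrite fE; apply: le_trans (LE S) _.
  apply: (@le_trans _ _ (E ^+ 2 * (quot_norm (quot_map S) + e / (E ^+ 2 + 1)))).
    by rewrite ler_wpM2l// ltW// -ltcR.
  rewrite mulrDr lerD2l mulrCA ler_piMr ?(ltW e0)//.
  by rewrite ler_pdivrMr ?ltr_wpDl//; lra.
pose fL : {linear nestquot N -> R[i]^o} :=
  HB.pack f (GRing.isLinear.Build _ _ _ _ f fl).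
exists (exist _ fL (linear_rnorm_continuous fl fb)) => S.
rewrite /= fE; exact: cL.
Qed.

(** * The double limit argument against weak compactness *)

Theorem theorem5p1 (R : realType) (H : hilbertType R) (N : nest H)
    (a b : nestalg N) :
  weakly_compact_operator (V := nestquot N) (W := nestquot N)
    (mulop (quot_map a) (quot_map b)) <->
  (mulop (quot_map a) (quot_map b) : nestquot N -> nestquot N) = (fun=> 0).
Proof.
have mulopE T : mulop (quot_map a) (quot_map b) (quot_map T) = quot_map (a * T * b).
  by rewrite /mulop !rmorphM.
split=> [wc|M0]; last first.
  apply: precompact_subset weakly_precompact0.
  by move=> _ [x _ <-] /=; have /(congr1 (fun g => g x)) /= := M0.
apply/funext => y; case: (quot_map_surj y) => x <-; rewrite mulopE.
suff axb : a * x * b \in @compact_ideal _ _ N.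
  by rewrite -(raddf0 (@quot_map _ _ N)); apply/quot_mapP; rewrite subr0.
apply: contrapT => /negP/noncompact_nest_blocks.
move=> [p [q [c [E [c0 pE qE q0 blocks]]]]].
have [U [UU ooU]] := @ultraFilterLemma nat \oo _.
have PU := @ultra_proper _ _ UU.
(* [k.+1 = 2 ^ n * j.*2.+1] splits the indices into infinitely many infinite
   classes [i k = n]. The functional along the [n]-th class is bounded below on the
   images of [T m] for all [m >= n], one along indices [k n] of class [n] vanishes
   on all of them, and a cluster point cannot satisfy both: this is Grothendieck's double
   limit criterion. *)
pose i k := logn 2 k.+1.
pose kk n j := (2 ^ n * j.*2.+1).-1.
have kkE n j : (kk n j).+1 = (2 ^ n * j.*2.+1)%N.
  by rewrite prednK// muln_gt0 expn_gt0.
have ikk n j : i (kk n j) = n.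
  rewrite /i kkE lognM ?expn_gt0// lognX logn_prime// eqxx muln1.
  by rewrite lognE /= dvdn2 /= odd_double addn0.
have kkj n j : (j <= kk n j)%N.
  rewrite -ltnS kkE; apply: (@leq_trans j.*2.+1); last first.
    by rewrite leq_pmull ?expn_gt0.
  by rewrite ltnS -addnn leq_addr.
have kkn n j : (n <= kk n j)%N.
  rewrite -ltnS kkE; apply: (@leq_trans (2 ^ n)); first exact: ltn_expl.
  by rewrite leq_pmulr.
have half_cvg (e : R) : 0 < e -> exists n0, forall n, (n0 <= n)%N -> 2^-1 ^+ n <= e.
  move=> e0; have /cvgrPdist_le/(_ _ e0)[n0 _ h] :=
    @cvg_geometric R 1 2^-1
      (ltac:(by rewrite gtr0_norm ?invr_gt0// invf_lt1 ?ltr1n)).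
  exists n0 => n /h; rewrite /= mul1r sub0r normrN ger0_norm//.
  by rewrite exprn_ge0 ?invr_ge0.
have subfun (k : nat -> nat) : (forall n, (n <= k n)%N) ->
    exists f : dual (nestquot N), forall S : nestalg N,
      (fun n => inner (S (p (k n))) (q (k n)) : R[i]^o) @ U -->
      (sval f (quot_map S) : R[i]^o).
  move=> kn.
  apply: (@quot_functional _ _ N U (p \o k) (q \o k) E UU ooU) => [n|n|] /=;
    [exact: pE|exact: qE|].
  (* The condition [n <= k n] keeps the reindexed sequence [q \o k] weakly null. *)
  move=> z; apply: (@cvg_comp _ _ _ k (fun n => inner z (q n) : R[i]^o) _ \oo).
    move=> A [n0 _ n0A]; exists n0 => // n /= n0n; apply: n0A.
    exact: leq_trans n0n (kn n).
  exact: q0.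
(* [T m] is the block operator attached to the classes up to [m]. *)
pose PT m (T : nestalg N) := opnorm T <= 1 /\
  forall j, let w := inner (a (T (b (p j)))) (q j) : R[i]^o in
    if (i j <= m)%N then c - 2^-1 ^+ j <= complex.Re w
    else rnorm w <= 2^-1 ^+ j.
have /choice[T TP] : forall m, exists T, PT m T.
  move=> m; have [T T1 TP] := blocks (fun k => (i k <= m)%N).
  by exists T.
have [|z zP'] := weak_cluster_point (u := fun m => quot_map (T m)) wc.
  move=> m; apply: le_trans (quot_norm_le _) _.
  by rewrite nestalg_normE (lecR _ 1); case: (TP m).
have zP (f : dual (nestquot N)) (e : R) m : 0 < e -> exists2 n, (m <= n)%N &
    rnorm (sval f z - sval f (quot_map (a * T n * b)) : R[i]^o) <= e.
  move=> e0; have d0 : 0 < e%:C by rewrite (ltcR 0).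
  have [n mn zn] := zP' f _ m d0; exists n => //.
  by rewrite -rnorm_le -mulopE; exact: ltW.
clear zP'.
have [S zE] := quot_map_surj z; rewrite -{}zE {z} in zP.
have c8 : 0 < c / 8 by rewrite divr_gt0.
pose Pk n l := [/\ i l = n, (n <= l)%N &
  c / 4 <= complex.Re (inner (S (p l)) (q l))].
have /choice[k kP] : forall n, exists l, Pk n l.
  (* Along class [n], [f] has real part at least [c / 2] on the image of [T m]. Passing to the
     cluster point and then to one coefficient of [S] costs [c / 8] each, leaving [c / 4]. *)
  move=> n; have [f fP] := subfun (kk n) (kkj n).
  have [m nm fm] := zP f _ n c8.
  have fge : c / 2 <= complex.Re (sval f (quot_map (a * T m * b))).
    apply: (cvg_Re_ge _ (fP _)); apply: ooU.
    have [|n0 hn0] := half_cvg (c / 2); first by rewrite divr_gt0.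
    exists n0 => // j /= n0j.
    have := (TP m).2 (kk n j); cbv zeta; rewrite ikk nm.
    by have := hn0 _ (leq_trans n0j (kkj n j)); lra.
  have [j fj] := filter_ex ((cvg_rnormP _ _ _).1 (fP S) _ c8).
  exists (kk n j); split; [exact: ikk|exact: kkn|].
  have := le_trans (Re_le_rnorm _) fm; have := le_trans (Re_le_rnorm _) fj.
  rewrite !raddfB /= !ler_norml => /andP[h1 h2] /andP[h3 h4]; lra.
have ik n : i (k n) = n by case: (kP n).
have kn n : (n <= k n)%N by case: (kP n).
(* The index [k n] has class [n], so for [n > m] it is outside the support of [T m], and [f]
   vanishes on the image of every [T m]. *)
have [f fP] := subfun k kn.
have [m _] := zP f _ 0%N c8.
have -> : sval f (quot_map (a * T m * b)) = 0.
  apply: (@cvg_unique R[i]^o _ _ _ _ _ (fP (a * T m * b))).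
    exact: norm_hausdorff.
  apply/cvg_rnormP => e e0; apply: ooU.
  have [n0 hn0] := half_cvg _ e0; exists (maxn n0 m.+1) => // n /=.
  rewrite geq_max => /andP[n0n mn]; rewrite sub0r rnormN.
  have := (TP m).2 (k n); cbv zeta; rewrite ik leqNgt mn /= => /le_trans; apply.
  exact: hn0 (leq_trans n0n (kn n)).
(* The cluster property bounds the modulus of [f] at the class of [S] by [c / 8], while its real
   part is at least [c / 4]. *)
rewrite subr0 => fS.
have : c / 4 <= complex.Re (sval f (quot_map S)).
  by apply: (cvg_Re_ge _ (fP S)); apply: nearW => n; case: (kP n).
have := le_trans (Re_le_rnorm _) fS; rewrite ler_norml => /andP[_]; lra.
Qed.
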